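(* For every knot $K$ in $S^3$ there exists an open neighborhood $U_K$ of $0\in\mathbb{C}$ such that for all $\alpha\in U_K$ (the quotients below being well-defined complex numbers) we have an asymptotic expansion, uniform on compact subsets of $U_K$ with respect to $\alpha$, $$J_{K,n}(e^{\alpha/n})\sim_{n\to\infty}\sum_{k=0}^{\infty}\frac{P_{K,k}(e^{\alpha})}{\Delta_K(e^{\alpha})^{2k+1}}\left(\frac{\alpha}{n}\right)^k .$$ In other words, for every $\alpha\in U_K$ and every integer $N\ge 0$, $$\lim_{n\to\infty}\left(\frac{n}{\alpha}\right)^N\left(J_{K,n}(e^{\alpha/n})-\sum_{k=0}^{N-1}\frac{P_{K,k}(e^{\alpha})}{\Delta_K(e^{\alpha})^{2k+1}}\left(\frac{\alpha}{n}\right)^k\right)=\frac{P_{K,N}(e^{\alpha})}{\Delta_K(e^{\alpha})^{2N+1}}\in\mathbb{C},$$ and, for each $N$, the convergence with respect to $\alpha$ is uniform on compact subsets of $U_K$.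
   Context: For a knot $K\subset S^3$ and an integer $n\ge 1$, $J_{K,n}(q)\in\mathbb{Z}[q^{\pm1}]$ is the colored Jones polynomial of $K$ (taken with zero framing) colored by the $n$-dimensional irreducible representation of $\mathfrak{sl}_2$, normalized to equal $1$ for the unknot. (Concretely: let $\langle\cdot\rangle$ be the Kauffman bracket of framed links in the variable $A$, with $q=A^{-4}$; let $S_0=1$, $S_1=z$, $S_{m+1}=zS_m-S_{m-1}$; and for a zero-framed knot interpret $z^m$ as its $m$ parallel copies, extended linearly. Then $J_{K,n}=\langle S_{n-1}(K)\rangle/\langle S_{n-1}(\text{unknot})\rangle$.) $J_{K,n}(e^{\alpha/n})$ denotes evaluation at $q=e^{\alpha/n}$. $\Delta_K(t)\in\mathbb{Z}[t^{\pm1}]$ is the Alexander polynomial of $K$, symmetrized by $\Delta_K(t^{-1})=\Delta_K(t)$ and normalized by $\Delta_K(1)=1$ and $\Delta_{\text{unknot}}(t)=1$. The Laurent polynomials $P_{K,k}$ are those of Rozansky's loop expansion (a known theorem): for every knot $K$ there is a (unique) sequence $P_{K,k}(q)\in\mathbb{Q}[q^{\pm1}]$, $k\ge0$, with $P_{K,0}(q)=1$, such that, for every $n\ge 1$, in the formal power series ring $\mathbb{Q}[[h]]$, $$J_{K,n}(e^{h})=\sum_{k=0}^\infty R_{K,k}(nh)\,h^k,\qquad R_{K,k}(x)=\frac{P_{K,k}(e^{x})}{\Delta_K(e^{x})^{2k+1}}\in\mathbb{Q}[[x]].$$ At $\alpha=0$ the expression $\left(\frac{n}{\alpha}\right)^N(\cdots)$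 is understood via its holomorphic extension: by the expansion above, the function in parentheses is divisible by $\alpha^N$ near $\alpha=0$, so the singularity at $\alpha=0$ is removable. *)

(* Defs.v *)
From HB Require Import structures.
From mathcomp Require Import all_boot all_order all_algebra.
From mathcomp Require Import complex.
From mathcomp Require Import all_classical all_reals all_analysis.

Set Implicit Arguments.
Unset Strict Implicit.
Unset Printing Implicit Defensive.

Import Order.TTheory GRing.Theory Num.Theory.
Import numFieldNormedType.Exports.

Local Open Scope ring_scope.

(* An oriented knot diagram in general position is cut by horizontal lines into
   elementary slices and read from bottom to top.  The strands met by a
   horizontal line are numbered 0, 1, 2, ... from left to right; [true] means
   that a strand is oriented upwards.  Every knot in S^3 is presented by such a
   diagram. *)

Inductive slice :=
| Cup of nat & bool   (* [Cup i b] creates strands i, i+1; strand i gets b *)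
| Cap of nat          (* [Cap i] joins strands i and i+1 *)
| Cross of nat & bool (* [Cross i s] crosses strands i and i+1; for s = true
                         (resp. false) the overstrand is the one whose lower
                         end is at i (resp. i+1) *).

Definition insert2 (T : Type) (i : nat) (x y : T) (s : seq T) : seq T :=
  take i s ++ [:: x; y] ++ drop i s.

Definition remove2 (T : Type) (i : nat) (s : seq T) : seq T :=
  take i s ++ drop i.+2 s.

Definition swap2 (T : Type) (x0 : T) (i : nat) (s : seq T) : seq T :=
  insert2 i (nth x0 s i.+1) (nth x0 s i) (remove2 i s).

(* [o] lists the orientations of the strands below the diagram [D]; no strand
   is left at the top. *)
Fixpoint closed_diagram (o : seq bool) (D : seq slice) : bool :=
  match D with
  | [::] => nilp o
  | Cup i b :: D' => (i <= size o)%N && closed_diagram (insert2 i b (~~ b) o) D'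
  | Cap i :: D' =>
      [&& (i.+1 < size o)%N, nth true o i != nth true o i.+1
        & closed_diagram (remove2 i o) D']
  | Cross i _ :: D' =>
      (i.+1 < size o)%N && closed_diagram (swap2 true i o) D'
  end.

(* Connectivity of what lies below a horizontal line: two strands carry the
   same label iff they are the two ends of one arc, so every label occurs
   exactly twice. *)
Definition cup_labels (i : nat) (l : seq nat) : seq nat :=
  let x := (\max_(y <- l) y).+1 in insert2 i x x l.

Definition cap_closes (i : nat) (l : seq nat) : bool :=
  nth 0%N l i == nth 0%N l i.+1.

Definition cap_labels (i : nat) (l : seq nat) : seq nat :=
  [seq if x == nth 0%N l i.+1 then nth 0%N l i else x | x <- remove2 i l].

Fixpoint components (l : seq nat) (D : seq slice) : nat :=
  match D with
  | [::] => 0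
  | Cup i _ :: D' => components (cup_labels i l) D'
  | Cap i :: D' => (cap_closes i l + components (cap_labels i l) D')%N
  | Cross i _ :: D' => components (swap2 0%N i l) D'
  end.

Record knot := Knot {
  diagram :> seq slice;
  _ : closed_diagram [::] diagram && (components [::] diagram == 1%N)
}.

(* A crossing [Cross i true] of two strands going up is right-handed, and
   reversing one of its two strands changes its sign. *)
Fixpoint writhe (o : seq bool) (D : seq slice) : int :=
  match D with
  | [::] => 0
  | Cup i b :: D' => writhe (insert2 i b (~~ b) o) D'
  | Cap i :: D' => writhe (remove2 i o) D'
  | Cross i s :: D' =>
      (if s == (nth true o i == nth true o i.+1) then 1 else -1)
      + writhe (swap2 true i o) D'
  end.

(* A curl of sign [s] on the strand [i], whose orientation is [b]. *)
Definition curl (i : nat) (b s : bool) : seq slice :=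
  [:: Cup i.+1 b; Cross i s; Cap i.+1].

(* The framing of a diagram is its blackboard framing, i.e. its writhe; it is
   brought to 0 by inserting |writhe| curls of the opposite sign right after
   the first slice, which is a cup whenever the diagram is closed. *)
Definition zero_framed (D : seq slice) : seq slice :=
  if D is Cup i b :: D' then
    let w := writhe [::] D in
    Cup i b :: flatten (nseq `|w|%N (curl i b (w < 0))) ++ D'
  else D.

(* [m] parallel copies, with respect to the blackboard framing. *)
Definition cable_slice (m : nat) (x : slice) : seq slice :=
  match x with
  | Cup i b => [seq Cup (i * m + k)%N b | k <- iota 0 m]
  | Cap i => [seq Cap (i * m + k)%N | k <- rev (iota 0 m)]
  | Cross i s =>
      [seq Cross (i * m + j + k)%N s | j <- rev (iota 0 m), k <- iota 0 m]
  end.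

Definition cable (m : nat) (D : seq slice) : seq slice :=
  flatten (map (cable_slice m) D).

(* The Laurent polynomial [lpoly * q ^- lshift]. *)
Record laurent (R : nzRingType) := Laurent { lpoly : {poly R}; lshift : nat }.

(* The value at [x] when the coefficients are read in [F] through [f]. *)
Definition leval (R : nzRingType) (F : fieldType) (f : R -> F)
    (L : laurent R) (x : F) : F :=
  (map_poly f (lpoly L)).[x] / x ^+ lshift L.

Definition levalZ (F : fieldType) (L : laurent int) (x : F) : F :=
  leval (fun z : int => z%:~R) L x.

Definition levalQ (F : fieldType) (L : laurent rat) (x : F) : F :=
  leval ratr L x.

(* Identities between Laurent polynomials over the integers are stated in this
   field, at its generator [genvar]. *)
Notation ratfun := {fraction {poly int}}.

Definition genvar : ratfun := tofrac 'X.

(* [bracket A l D] is the Kauffman bracket, with value 1 on the empty diagram,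
   of [D] placed above arcs whose ends are connected as described by [l]. *)
Fixpoint bracket (F : fieldType) (A : F) (l : seq nat) (D : seq slice) : F :=
  let delta := - A ^+ 2 - A ^- 2 in
  match D with
  | [::] => 1
  | Cup i _ :: D' => bracket A (cup_labels i l) D'
  | Cap i :: D' =>
      (if cap_closes i l then delta else 1) * bracket A (cap_labels i l) D'
  | Cross i s :: D' =>
      let a := if s then A else A^-1 in
      a * bracket A l D' +
      a^-1 * (if cap_closes i l then delta else 1)
           * bracket A (cup_labels i (cap_labels i l)) D'
  end.

(* [(S_m, S_(m+1))] *)
Fixpoint chebyshev2 (m : nat) : {poly int} * {poly int} :=
  if m is m'.+1 then
    let p := chebyshev2 m' in (p.2, 'X * p.2 - p.1)
  else (1, 'X).

Definition chebyshev (m : nat) : {poly int} := (chebyshev2 m).1.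

(* The bracket of [p] evaluated at the framed diagram [D]. *)
Definition cable_bracket (p : {poly int}) (D : seq slice) : ratfun :=
  \sum_(m < size p) (p`_m)%:~R * bracket genvar [::] (cable m D).

Definition unknot_diagram : seq slice := [:: Cup 0 true; Cap 0].

(* [J] is the colored Jones polynomial of [K] in color [n]: the quotient of
   the two brackets, after substituting q = A^-4; this determines J. *)
Definition is_colored_jones (K : knot) (n : nat) (J : laurent int) : Prop :=
  levalZ J (genvar ^- 4) =
  cable_bracket (chebyshev n.-1) (zero_framed K) /
  cable_bracket (chebyshev n.-1) unknot_diagram.

(* Fox derivatives of the Wirtinger presentation.  Every cup and every lower
   passage of a crossing starts a new generator, every cap identifies two
   generators, and every crossing gives the relation
     (1 - t) * over + t * right - left = 0,
   where right and left are the two halves of the understrand as seen from the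
   oriented overstrand.  [l] lists the generator and the orientation of each
   strand below [D], and generators from [g] on are unused. *)
Definition row_of (j : nat) (c : {poly int}) : nat -> {poly int} :=
  fun k => if k == j then c else 0.

Fixpoint relations (l : seq (nat * bool)) (g : nat) (D : seq slice)
    : seq (nat -> {poly int}) :=
  match D with
  | [::] => [::]
  | Cup i b :: D' => relations (insert2 i (g, b) (g, ~~ b) l) g.+1 D'
  | Cap i :: D' =>
      let x := (nth (0%N, true) l i).1 in
      let y := (nth (0%N, true) l i.+1).1 in
      (fun k => row_of x 1 k - row_of y 1 k) :: relations (remove2 i l) g D'
  | Cross i s :: D' =>
      let left_end := nth (0%N, true) l i in
      let right_end := nth (0%N, true) l i.+1 in
      let over := if s then left_end else right_end in
      let under := if s then right_end else left_end in
      let new := (g, under.2) in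
      let right := if s == over.2 then under.1 else g in
      let left := if s == over.2 then g else under.1 in
      (fun k => row_of over.1 (1 - 'X) k + row_of right 'X k - row_of left 1 k)
      :: relations (if s then insert2 i new over (remove2 i l)
                    else insert2 i over new (remove2 i l)) g.+1 D'
  end.

(* A closed diagram has as many relations as generators; the last relation and
   the last generator are deleted.  Another choice changes the minor by a unit
   of the ring of Laurent polynomials. *)
Definition alexander_minor (D : seq slice) : {poly int} :=
  let r := relations [::] 0 D in
  \det (\matrix_(i < (size r).-1, j < (size r).-1) nth (fun=> 0) r i j).

(* The symmetry and the value at 1 remove the indeterminacy by a unit. *)
Definition is_alexander (K : knot) (Delta : laurent int) : Prop :=
  [/\ exists (b : bool) (k : int),
        levalZ Delta genvar =
        (-1) ^+ b * genvar ^ k * tofrac (alexander_minor K),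
      levalZ Delta genvar^-1 = levalZ Delta genvar
    & levalZ Delta (1 : rat) = 1].

(* Formal power series over the rationals, as coefficient sequences. *)
Definition fps := nat -> rat.

Definition fps_mul (f g : fps) : fps :=
  fun n => \sum_(i < n.+1) f i * g (n - i)%N.

Definition fps_pow (f : fps) (k : nat) : fps :=
  iter k (fps_mul f) (fun n => (n == 0%N)%:R).

(* The series L(e^x). *)
Definition laurent_exp (R : nzRingType) (f : R -> rat) (L : laurent R) : fps :=
  fun j => \sum_(i < size (lpoly L))
    f (lpoly L)`_i * (i%:R - (lshift L)%:R) ^+ j / j`!%:R.

Definition laurent_expZ (L : laurent int) : fps :=
  laurent_exp (fun z : int => z%:~R) L.

Definition laurent_expQ (L : laurent rat) : fps := laurent_exp id L.

(* [S k] is the series P_k(e^x) / Delta(e^x)^(2k+1), which is well defined as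
   Delta(1) = 1; the second identity compares the coefficients of h^m in
   J_n(e^h) and in the sum of the S_k(nh) h^k. *)
Definition is_loop_expansion (J : nat -> laurent int) (Delta : laurent int)
    (P : nat -> laurent rat) : Prop :=
  lpoly (P 0%N) = 'X^(lshift (P 0%N)) /\
  exists S : nat -> fps,
    (forall k, fps_mul (S k) (fps_pow (laurent_expZ Delta) (2 * k).+1%N)
               =1 laurent_expQ (P k)) /\
    (forall n m, (0 < n)%N ->
       laurent_expZ (J n) m = \sum_(k < m.+1) S k (m - k)%N * n%:R ^+ (m - k)).

Definition cexp (R : realType) (z : R[i]) : R[i] :=
  Complex (expR (complex.Re z) * cos (complex.Im z))
          (expR (complex.Re z) * sin (complex.Im z)).

(* P_k(e^alpha) / Delta(e^alpha)^(2k+1) *)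
Definition loop_term (R : realType) (Delta : laurent int)
    (P : nat -> laurent rat) (k : nat) (alpha : R[i]) : R[i] :=
  levalQ (P k) (cexp alpha) / levalZ Delta (cexp alpha) ^+ (2 * k).+1%N.

Definition loop_error (R : realType) (J : nat -> laurent int)
    (Delta : laurent int) (P : nat -> laurent rat) (N n : nat)
    (alpha : R[i]) : R[i] :=
  (n%:R / alpha) ^+ N *
  (levalZ (J n) (cexp (alpha / n%:R)) -
   \sum_(k < N) loop_term Delta P k alpha * (alpha / n%:R) ^+ k).

(* Main.v *)
Require Import Defs.
From HB Require Import structures.
From mathcomp Require Import all_boot all_order all_algebra.
From mathcomp Require Import complex.
From mathcomp Require Import all_classical all_reals all_analysis.
From mathcomp Require Import zify ring lra.

(** Let [f_n(a) = J_n(e^(a/n))] and let [S_k] be the power series of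
    [P_k(e^x) / Delta(e^x)^(2k+1)].  By the loop expansion the coefficient of
    [a^m] in [f_n] is [\sum_(k <= m) S_k(m-k) n^-k], that is, [n^-m] times a
    polynomial in [n] of degree at most [m].  The coefficient of [a^d] in the
    rescaled remainder [(n/a)^N (f_n(a) - \sum_(k < N) ...)] is therefore
    [remainder_coef N n d = \sum_(i <= d) S_(N+i)(d-i) n^-i].

    The heart of the proof is [remainder_coef_bound]: these numbers are at most
    [C_N L^d], where [L] depends neither on [n] nor on [N].  On the disc
    [|a| < 1/(2L)] every remainder is then bounded uniformly in [n], and since
    the [N]-th remainder differs from its expected limit by [a/n] times the
    [(N+1)]-st one ([loop_error_shift]), it converges to it uniformly, with
    error [O(1/n)].

    The bound rests on three facts.

    - For [n |h| <= 1/2], [|J_n(e^h)| <= G^n] ([colored_jones_bound]).  The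
      bracket at [A = e^(-h/4)] is a state sum over tensors on a
      two-dimensional space, in which a crossing acts by a matrix whose rows
      have l1-norm [1 + O(1/n)], because at [A = 1] it is the transposition of
      the two factors.  A cable with [m <= n] strands has [O(n^2)] crossings and
      [O(n)] cups and caps, so its bracket is [exp(O(n))]; the denominator, a
      quantum integer, stays away from 0.  By the Cauchy estimate the
      coefficient of [a^d] in [f_n] is at most [G^n 2^d], which is exponential
      in [d] as long as [n <= d + 1].

    - For [n > d], [n^d remainder_coef N n d] is a polynomial in [n] of degree
      at most [d], whose values at [1, ..., d+1] were just estimated; Newton
      interpolation extends the estimate to all [n] at the cost of a factor
      exponential in [d] ([interpolation_growth]).

    - [|S_k(j)| <= C_k M^j] with [M] independent of [k] ([loop_coef_bound]):
      [P_k(e^x)] is entire, and dividing by [Delta(e^x)] preserves a bound of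
      this shape with the same [M].  This is what makes [L], hence the
      neighborhood of 0, independent of [N].

    All functions involved are given beforehand, so that convergence of a
    series always means convergence to a known value, at a geometric rate
    ([converges_at_rate]). *)

Set Implicit Arguments.
Unset Strict Implicit.
Unset Printing Implicit Defensive.

Import Order.TTheory GRing.Theory Num.Theory.
Import numFieldNormedType.Exports.

Local Open Scope classical_set_scope.
Local Open Scope ring_scope.

(** * The real-valued modulus of a complex number *)

Section Modulus.
Variable R : realType.
Implicit Types z w : R[i].

(** The norm of [R[i]] takes its values in [R[i]], which is only partially ordered;
    estimates are carried out in the real field instead. *)
Definition modulus z : R := complex.Re `|z|.

Lemma normE z : `|z| = (modulus z)%:C%C.
Proof. by rewrite /modulus normc_def. Qed.

Lemma modulus_ge0 z : 0 <= modulus z.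
Proof. by rewrite -ler0c -normE. Qed.

Lemma modulus0 : modulus 0 = 0.
Proof. by rewrite /modulus normr0. Qed.

Lemma modulus1 : modulus 1 = 1.
Proof. by rewrite /modulus normr1. Qed.

Lemma modulusM z w : modulus (z * w) = modulus z * modulus w.
Proof. by apply: complexI; rewrite rmorphM /= -!normE normrM. Qed.

Lemma modulusX z n : modulus (z ^+ n) = modulus z ^+ n.
Proof. by elim: n => [|n IH]; rewrite ?expr0 ?modulus1// !exprS modulusM IH. Qed.

Lemma modulusV z : modulus z^-1 = (modulus z)^-1.
Proof. by apply: complexI; rewrite fmorphV /= -!normE normfV. Qed.

Lemma modulusN z : modulus (- z) = modulus z.
Proof. by rewrite /modulus normrN. Qed.

Lemma modulusD z w : modulus (z + w) <= modulus z + modulus w.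
Proof. by rewrite -lecR rmorphD /= -!normE ler_normD. Qed.

Lemma modulusB z w : modulus (z - w) <= modulus z + modulus w.
Proof. by rewrite -(modulusN w) modulusD. Qed.

Lemma modulus_eq0 z : (modulus z == 0) = (z == 0).
Proof. by rewrite -[RHS]normr_eq0 normE fmorph_eq0. Qed.

Lemma modulus_gt0 z : (0 < modulus z) = (z != 0).
Proof. by rewrite lt_def modulus_ge0 andbT modulus_eq0. Qed.

Lemma modulus_sum (I : Type) (r : seq I) (P : pred I) (f : I -> R[i]) :
  modulus (\sum_(i <- r | P i) f i) <= \sum_(i <- r | P i) modulus (f i).
Proof.
elim/big_ind2: _ => [|x1 x2 y1 y2 h1 h2|//]; first by rewrite modulus0.
by rewrite (le_trans (modulusD _ _))// lerD.
Qed.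

Lemma modulus_real (x : R) : modulus x%:C%C = `|x|.
Proof. by rewrite /modulus normc_def /= expr0n /= addr0 sqrtr_sqr. Qed.

Lemma modulus_nat n : modulus n%:R = n%:R.
Proof. by rewrite /modulus normr_nat -(rmorph_nat (real_complex R)). Qed.

Lemma Re_le_modulus z : complex.Re z <= modulus z.
Proof.
apply: le_trans (ler_norm _) _.
by have := normc_ge_Re z; rewrite normE lecR.
Qed.

Lemma modulus_int (m : int) : modulus m%:~R = `|m%:~R|.
Proof. by rewrite -(rmorph_int (real_complex R)) modulus_real. Qed.

End Modulus.

(** * The state sum of the Kauffman bracket *)

Section StateSum.
Variables (F : fieldType) (A : F).
Hypothesis A_neq0 : A != 0.

(** The cup and the cap are mutually inverse pairings of a two-dimensional space
    whose composite is [- A^2 - A^-2], so that they represent the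
    Temperley-Lieb category. *)
Definition cup_weight (b c : bool) : F :=
  if b == c then 0 else if b then A else - A^-1.

Definition cap_weight (b c : bool) : F :=
  if b == c then 0 else if b then - A else A^-1.

Definition loop_value : F := - A ^+ 2 - A ^- 2.

Lemma cap_cup_loop :
  \sum_(b : bool) \sum_(c : bool) cap_weight b c * cup_weight b c = loop_value.
Proof.
by rewrite !big_bool /cap_weight /cup_weight /loop_value /=; field.
Qed.

(** With [zigzag_left], the isotopy that straightens a strand. *)
Lemma zigzag_right (b : bool) (f : bool -> F) :
  \sum_(c : bool) \sum_(e : bool) cap_weight c e * (cup_weight b c * f e) = f b.
Proof.
by rewrite !big_bool /cap_weight /cup_weight; case: b => /=; field.
Qed.

Lemma zigzag_left (d : bool) (f : bool -> F) :
  \sum_(c : bool) \sum_(e : bool) cap_weight c e * (cup_weight e d * f c) = f d.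
Proof.
by rewrite !big_bool /cap_weight /cup_weight; case: d => /=; field.
Qed.

(** The tensor of a planar matching, its entries being indexed by the states of
    the strands.  The generation by insertion of innermost arcs encodes
    planarity, without which capping two strands would not act on tensors as on
    matchings.  It is a relation, so that only the states of the right length
    matter. *)
Inductive matching_tensor : seq nat -> (seq bool -> F) -> Prop :=
| MatchingNil v : v [::] = 1 -> matching_tensor [::] v
| MatchingCup l1 l2 x v w :
    x \notin l1 ++ l2 -> matching_tensor (l1 ++ l2) v ->
    (forall s1 b c s2, size s1 = size l1 -> size s2 = size l2 ->
       w (s1 ++ [:: b, c & s2]) = cup_weight b c * v (s1 ++ s2)) ->
    matching_tensor (l1 ++ [:: x, x & l2]) w.

Lemma matching_tensor_inj l v (f : nat -> nat) :
  {in l &, injective f} -> matching_tensor l v -> matching_tensor (map f l) v.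
Proof.
move=> f_inj lv; elim: lv f_inj => [w w1 _|l1 l2 x u w xl lu IH uw f_inj].
  exact: MatchingNil.
have sub y : y \in l1 ++ l2 -> y \in l1 ++ [:: x, x & l2].
  by rewrite !mem_cat !inE => /orP[->//|->]; rewrite !orbT.
rewrite map_cat /=; apply: (@MatchingCup _ _ _ u).
- rewrite -map_cat; apply/mapP => -[y yl fxy]; move: xl.
  by rewrite (f_inj x y _ (sub _ yl) fxy) ?yl// mem_cat mem_head orbT.
- by rewrite -map_cat; apply: IH => y z yl zl; apply: f_inj; exact: sub.
- by move=> s1 b c s2; rewrite !size_map; exact: uw.
Qed.

(** The possible relative positions of two adjacent pairs in one sequence. *)
Lemma cat2_eq_cases (T : Type) (u1 u2 w1 w2 : seq T) (a b c d : T) :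
  u1 ++ [:: a, b & u2] = w1 ++ [:: c, d & w2] ->
  [\/ [/\ u1 = w1, a = c, b = d & u2 = w2],
      [/\ u1 = rcons w1 c, a = d & w2 = b :: u2],
      [/\ w1 = rcons u1 a, b = c & u2 = d :: w2]
    | (exists t, u1 = w1 ++ [:: c, d & t] /\ w2 = t ++ [:: a, b & u2]) \/
      (exists t, w1 = u1 ++ [:: a, b & t] /\ u2 = t ++ [:: c, d & w2])].
Proof.
elim: u1 w1 => [|e u1 IH] [|e' w1] /=.
- by case=> -> -> ->; constructor 1.
- case: w1 => [|e'' w1] /= [-> -> ->]; first by constructor 3.
  by constructor 4; right; exists w1.
- case: u1 {IH} => [|e'' u1] /= [-> -> <-]; first by constructor 2.
  by constructor 4; left; exists u1.
- case=> -> /IH [[-> -> -> ->]|[-> -> ->]|[-> -> ->]|[[t [-> ->]]|[t [-> ->]]]].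
  + by constructor 1.
  + by constructor 2.
  + by constructor 3.
  + by constructor 4; left; exists t.
  + by constructor 4; right; exists t.
Qed.

Lemma take2_drop (T : Type) (x0 : T) k s : (k.+1 < size s)%N ->
  s = take k s ++ [:: nth x0 s k, nth x0 s k.+1 & drop k.+2 s].
Proof. by move=> ks; rewrite -!drop_nth ?cat_take_drop// ltnW. Qed.

Definition merge_labels (y z : nat) : nat -> nat :=
  fun x => if x == z then y else x.

Lemma merge_labels_id y z l : z \notin l -> map (merge_labels y z) l = l.
Proof.
move=> zl; rewrite -[RHS]map_id; apply/eq_in_map => x xl; rewrite /merge_labels.
by case: eqP => // xz; rewrite -xz xl in zl.
Qed.

(** Capping a matching agrees with contracting its tensor.  By induction on the
    insertion of arcs: the cap meets the last arc in both ends (a loop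
    appears), in one end (a zigzag is straightened), or not at all (the two
    operations commute). *)
Lemma matching_tensor_cap l1 y z l2 v :
  matching_tensor (l1 ++ [:: y, z & l2]) v ->
  exists w, matching_tensor (map (merge_labels y z) (l1 ++ l2)) w /\
    forall s1 s2, size s1 = size l1 -> size s2 = size l2 ->
      \sum_(b : bool) \sum_(c : bool) cap_weight b c * v (s1 ++ [:: b, c & s2]) =
      (if y == z then loop_value else 1) * w (s1 ++ s2).
Proof.
move Dl: (_ ++ _) => l lv.
elim: lv l1 l2 y z Dl => [w w1|m1 m2 x u w xm mu IH uw] l1 l2 y z.
  by case: l1.
move=> Dl; case: (cat2_eq_cases Dl) => {Dl}; last case.
(* The arc is closed up by the cap. *)
- case=> Dl1 -> -> Dl2; rewrite {}Dl1 {}Dl2; exists u; split.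
    by rewrite merge_labels_id.
  move=> s1 s2 sz1 sz2; rewrite eqxx -cap_cup_loop mulr_suml.
  apply: eq_bigr => b _; rewrite mulr_suml; apply: eq_bigr => c _.
  by rewrite uw// mulrA.
(* The cap joins the right end of the arc to the next strand, whose label it
   passes on to the partner of that strand. *)
- case=> -> Dy Dm2; rewrite {}Dy {y}; rewrite {}Dm2 in xm mu IH uw *.
  rewrite -cats1; have xz : (x == z) = false.
    by apply: contraNF xm => /eqP->; rewrite mem_cat mem_head orbT.
  exists u; split.
    have -> : map (merge_labels x z) ((m1 ++ [:: x]) ++ l2) =
              map (merge_labels x z) (m1 ++ z :: l2).
      by rewrite !map_cat /= -catA /= /merge_labels eqxx xz.
    apply: matching_tensor_inj mu => p q pm qm; rewrite /merge_labels.
    case: eqP => [->|_]; case: eqP => [->|_]// E.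
      by rewrite E qm in xm.
    by rewrite -E pm in xm.
  move=> s1 s2; rewrite size_cat /= addn1; case/lastP: s1 => [//|s1 d].
  rewrite size_rcons => -[sz1] sz2; rewrite xz mul1r cat_rcons.
  rewrite -(zigzag_right d (fun e => u (s1 ++ e :: s2))).
  apply: eq_bigr => c _; apply: eq_bigr => e _; congr (_ * _).
  by rewrite cat_rcons uw//= sz2.
(* The cap joins the left end of the arc to the previous strand. *)
- case=> Dm1 -> Dl2; rewrite {}Dm1 {}Dl2 in xm mu IH uw *.
  rewrite -cats1 in xm mu uw *.
  have xy : (y == x) = false.
    apply: contraNF xm => /eqP->.
    by rewrite !mem_cat inE eqxx orbT.
  exists u; split.
    have -> : map (merge_labels y x) (l1 ++ x :: m2) =
              map (merge_labels y x) ((l1 ++ [:: y]) ++ m2).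
      by rewrite !map_cat /= -catA /= /merge_labels eqxx xy.
    by rewrite merge_labels_id.
  move=> s1 [//|d s2] sz1 /= [sz2]; rewrite xy mul1r.
  rewrite -(zigzag_left d (fun e => u (s1 ++ e :: s2))).
  apply: eq_bigr => c _; apply: eq_bigr => e _; congr (_ * _).
  have -> : s1 ++ [:: c, e, d & s2] = (s1 ++ [:: c]) ++ [:: e, d & s2].
    by rewrite -catA.
  by rewrite uw ?size_cat ?sz1// -catA.
(* The cap lies to the right of the arc. *)
- case=> t [Dl1 Dm2]; rewrite {}Dl1 {}Dm2 in xm mu IH uw *.
  rewrite -!catA /=.
  have [|u' [mu' uu']] := IH (m1 ++ t) l2 y z; first by rewrite -catA.
  have xl : x \notin m1 ++ t ++ l2 /\ (x == y) = false /\ (x == z) = false.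
    move: xm; rewrite !mem_cat !inE !negb_or => /and5P[-> -> /negPf-> /negPf-> ->].
    by [].
  case: xl => xl [xy xz].
  pose f := merge_labels y z.
  exists (fun s => cup_weight (nth true s (size m1)) (nth true s (size m1).+1)
                   * u' (take (size m1) s ++ drop (size m1).+2 s)).
  have fx : f x = x by rewrite /f /merge_labels xz.
  split.
    rewrite map_cat /= -/f fx; apply: (@MatchingCup _ _ _ u').
    - rewrite -map_cat; apply/mapP => -[p pl]; rewrite /f /merge_labels.
      case: ifP => [_ E|_ E]; first by rewrite E eqxx in xy.
      by rewrite -E (negPf xl) in pl.
    - by rewrite -map_cat catA.
    - move=> s1 b c s2; rewrite !size_map => <- _.
      rewrite !nth_cat ltnn subnn /= ltnNge leqnSn /= subSn// subnn /=.
      rewrite take_size_cat// drop_cat ltnNge (leq_trans (leqnSn _))//=.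
      by rewrite subSn// subSnn /= drop0.
  move=> s1 s2; rewrite !size_cat /= => sz1 sz2.
  have sz1' : (size m1 <= size s1)%N by rewrite sz1 leq_addr.
  have Ds1 : s1 = take (size m1) s1 ++
      [:: nth true s1 (size m1), nth true s1 (size m1).+1
        & drop (size m1).+2 s1].
    by apply: take2_drop; rewrite sz1 !addnS !ltnS leq_addr.
  have szt : size (take (size m1) s1) = size m1 by rewrite size_takel.
  move: Ds1 szt.
  move: (take _ _) (drop _ _) (nth _ _ _) (nth _ _ _) => r1 r2 c' b' Ds1 szr.
  rewrite {}Ds1 {sz1'} in sz1 *.
  rewrite -catA /= -szr !nth_cat ltnn subnn /= ltnNge leqnSn /= subSn// subnn /=.
  rewrite take_size_cat// drop_cat ltnNge (leq_trans (leqnSn _))//=.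
  rewrite subSn// subSnn /= drop0.
  move: sz1; rewrite size_cat /= szr => /eqP; rewrite eqn_add2l => /eqP [szr2].
  rewrite catA mulrCA -uu' ?size_cat ?szr ?szr2//.
  rewrite mulr_sumr; apply: eq_bigr => b _; rewrite mulr_sumr.
  apply: eq_bigr => c _; rewrite -catA /= uw ?size_cat//= ?szr2 ?sz2//.
  by rewrite mulrCA -catA.
(* The cap lies to the left of the arc. *)
- case=> t [Dm1 Dl2]; rewrite {}Dm1 {}Dl2 in xm mu IH uw *.
  have [|u' [mu' uu']] := IH l1 (t ++ m2) y z; first by rewrite -catA.
  have xl : x \notin l1 ++ t ++ m2 /\ (x == y) = false /\ (x == z) = false.
    move: xm; rewrite !mem_cat !inE !negb_or -!andbA.
    by move=> /and5P[-> /negPf-> /negPf-> -> ->].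
  case: xl => xl [xy xz].
  pose f := merge_labels y z.
  pose k := (size l1 + size t)%N.
  exists (fun s => cup_weight (nth true s k) (nth true s k.+1)
                   * u' (take k s ++ drop k.+2 s)).
  have fx : f x = x by rewrite /f /merge_labels xz.
  have key s1 b c s2 : size s1 = k ->
    cup_weight (nth true (s1 ++ [:: b, c & s2]) k) (nth true (s1 ++ [:: b, c & s2]) k.+1)
    * u' (take k (s1 ++ [:: b, c & s2]) ++ drop k.+2 (s1 ++ [:: b, c & s2])) =
    cup_weight b c * u' (s1 ++ s2).
    move=> <-.
    rewrite !nth_cat ltnn subnn /= ltnNge leqnSn /= subSn// subnn /=.
    rewrite take_size_cat// drop_cat ltnNge (leq_trans (leqnSn _))//=.
    by rewrite subSn// subSnn /= drop0.
  split.
    rewrite catA map_cat /= -/f fx; apply: (@MatchingCup _ _ _ u').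
    - rewrite -map_cat; apply/mapP => -[p]; rewrite -catA => pl; rewrite /f /merge_labels.
      case: ifP => [_ E|_ E]; first by rewrite E eqxx in xy.
      by rewrite -E (negPf xl) in pl.
    - by rewrite -map_cat -catA.
    - by move=> s1 b c s2; rewrite !size_map => sz1 _; rewrite key// sz1 size_cat.
  move=> s1 s2; rewrite !size_cat /= => sz1 sz2.
  have Ds2 : s2 = take (size t) s2 ++
      [:: nth true s2 (size t), nth true s2 (size t).+1 & drop (size t).+2 s2].
    by apply: take2_drop; rewrite sz2 !addnS !ltnS leq_addr.
  have szt : size (take (size t) s2) = size t by rewrite size_takel// sz2 leq_addr.
  move: Ds2 szt.
  move: (take _ _) (drop _ _) (nth _ _ _) (nth _ _ _) => r1 r2 c' b' Ds2 szr.
  rewrite {}Ds2 in sz2 *.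
  move: sz2; rewrite size_cat /= szr => /eqP; rewrite eqn_add2l => /eqP [szr2].
  rewrite catA key; last by rewrite size_cat sz1 szr.
  rewrite -catA mulrCA -uu' ?size_cat ?szr ?szr2//.
  rewrite mulr_sumr; apply: eq_bigr => b _; rewrite mulr_sumr.
  apply: eq_bigr => c _.
  have -> : s1 ++ [:: b, c & r1 ++ [:: b', c' & r2]] =
            (s1 ++ [:: b, c & r1]) ++ [:: b', c' & r2] by rewrite -catA.
  rewrite uw ?size_cat /= ?sz1 ?szr ?szr2//.
  by rewrite mulrCA -catA.
Qed.
End StateSum.

(** The part of [closed_diagram] that the bracket depends on. *)
Fixpoint well_formed (k : nat) (D : seq slice) : bool :=
  match D with
  | [::] => k == 0%N
  | Cup i _ :: D' => (i <= k)%N && well_formed k.+2 D'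
  | Cap i :: D' => (i.+1 < k)%N && well_formed (k - 2)%N D'
  | Cross i _ :: D' => (i.+1 < k)%N && well_formed k D'
  end.

Lemma size_insert2 (T : Type) i (x y : T) s : (i <= size s)%N ->
  size (insert2 i x y s) = (size s).+2.
Proof.
move=> ik; rewrite /insert2 !size_cat /= size_takel// size_drop.
by rewrite !addnS subnKC.
Qed.

Lemma size_remove2 (T : Type) i (s : seq T) : (i.+1 < size s)%N ->
  size (remove2 i s) = (size s - 2)%N.
Proof.
move=> ik; rewrite /remove2 size_cat size_drop size_takel; last by lia.
lia.
Qed.

Lemma remove2K (s1 s2 : seq bool) b c :
  remove2 (size s1) (s1 ++ [:: b, c & s2]) = s1 ++ s2.
Proof.
rewrite /remove2 take_size_cat// drop_cat ltnNge (leq_trans (leqnSn _))//=.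
by rewrite subSn// subSnn /= drop0.
Qed.

Lemma max_label_notin (l : seq nat) : (\max_(y <- l) y).+1 \notin l.
Proof.
apply/negP => /(@leq_bigmax_seq _ _ xpredT (fun y => y)) /(_ isT).
by rewrite ltnn.
Qed.

Section Run.
Variables (F : fieldType) (A : F).

Definition cup_op (i : nat) (v : seq bool -> F) : seq bool -> F :=
  fun s => cup_weight A (nth true s i) (nth true s i.+1) * v (remove2 i s).

Definition cap_op (i : nat) (v : seq bool -> F) : seq bool -> F :=
  fun s => \sum_(b : bool) \sum_(c : bool) cap_weight A b c * v (insert2 i b c s).

Definition cross_op (a : F) (i : nat) (v : seq bool -> F) : seq bool -> F :=
  fun s => a * v s + a^-1 * cup_op i (cap_op i v) s.

Fixpoint state_sum (v : seq bool -> F) (D : seq slice) : F :=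
  match D with
  | [::] => v [::]
  | Cup i _ :: D' => state_sum (cup_op i v) D'
  | Cap i :: D' => state_sum (cap_op i v) D'
  | Cross i s :: D' => state_sum (cross_op (if s then A else A^-1) i v) D'
  end.

Lemma state_sum_ext v w k D : well_formed k D ->
  (forall s, size s = k -> v s = w s) -> state_sum v D = state_sum w D.
Proof.
elim: D v w k => [|[i b|i|i s] D IH] v w k /=.
- by move=> /eqP-> ->.
- case/andP=> ik wfD vw; apply: (IH _ _ k.+2) => // t tk.
  by rewrite /cup_op vw// size_remove2 tk// subSS subSS subn0.
- case/andP=> ik wfD vw; apply: (IH _ _ (k - 2)%N) => // t tk.
  rewrite /cap_op; apply: eq_bigr => b _; apply: eq_bigr => c _.
  by rewrite vw// size_insert2 tk; lia.
- case/andP=> ik wfD vw; apply: (IH _ _ k) => // t tk.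
  rewrite /cross_op vw// /cup_op; congr (_ + _ * (_ * _)).
  rewrite /cap_op; apply: eq_bigr => b _; apply: eq_bigr => c _.
  by rewrite vw// size_insert2 size_remove2 tk; lia.
Qed.

(** Linearity matches the two summands of [bracket] at a crossing with the two
    summands of [cross_op]. *)
Lemma state_sum_linear a b u v D :
  state_sum (fun s => a * u s + b * v s) D = a * state_sum u D + b * state_sum v D.
Proof.
have capD i x y (f g : seq bool -> F) s :
    cap_op i (fun s => x * f s + y * g s) s =
    x * cap_op i f s + y * cap_op i g s.
  by rewrite /cap_op !big_bool /=; ring.
elim: D u v => [|[i c|i|i s] D IH] u v //=; rewrite -IH; congr state_sum;
  apply/funext => t.
- by rewrite /cup_op; ring.
- exact: capD.
- by rewrite /cross_op /cup_op capD; ring.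
Qed.

Hypothesis A_neq0 : A != 0.

(** The recursion defining [bracket] is followed by the tensors of matchings. *)
Lemma bracket_state_sum l v D :
  matching_tensor A l v -> well_formed (size l) D ->
  bracket A l D = state_sum v D.
Proof.
have capP i l1 v1 : (i.+1 < size l1)%N -> matching_tensor A l1 v1 ->
  exists w, [/\ matching_tensor A (cap_labels i l1) w,
     size (cap_labels i l1) = (size l1 - 2)%N &
     forall s, size s = (size l1 - 2)%N ->
       cap_op i v1 s = (if cap_closes i l1 then loop_value A else 1) * w s].
  move=> il lv; rewrite (take2_drop 0%N il) in lv.
  have [w [lw vw]] := matching_tensor_cap A_neq0 lv.
  exists w; split; first by [].
    by rewrite size_map size_remove2.
  move=> s sz; have szi : size (take i s) = i by rewrite size_takel; lia.
  rewrite -[in RHS](cat_take_drop i s) -vw ?size_drop ?sz//; last 2 first.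
    by rewrite szi size_takel; lia.
    by lia.
have cupP i l1 v1 : (i <= size l1)%N -> matching_tensor A l1 v1 ->
  matching_tensor A (cup_labels i l1) (cup_op i v1).
  move=> il lv; apply: (@MatchingCup _ _ _ _ _ v1); rewrite ?cat_take_drop//.
    exact: max_label_notin.
  move=> s1 b c s2; rewrite size_takel// => si _.
  rewrite /cup_op -{3}si remove2K -si !nth_cat ltnn subnn /= ltnNge leqnSn /=.
  by rewrite subSnn.
elim: D l v => [|[i b|i|i s] D IH] l v lv /=.
- move=> /eqP /size0nil l0; case: lv l0 => [w w1 _|l1 l2 x u w _ _ _]; first by rewrite w1.
  by case: l1.
- case/andP=> il wfD; apply: IH; first exact: cupP.
  by rewrite size_insert2.
- case/andP=> il wfD; have [w [lw sz vw]] := capP _ _ _ il lv.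
  rewrite (IH _ _ lw) ?sz// -[LHS]addr0 -[X in _ + X](mul0r (state_sum w D)).
  rewrite -state_sum_linear; apply: (state_sum_ext wfD) => t tk.
  by rewrite vw// mul0r addr0.
- case/andP=> il wfD; have [w [lw sz vw]] := capP _ _ _ il lv.
  have ik : (i <= size (cap_labels i l))%N by rewrite sz; lia.
  have szl : size (cup_labels i (cap_labels i l)) = size l.
    by rewrite size_insert2// sz; lia.
  rewrite (IH _ _ lv)// (IH _ _ (cupP i _ _ ik lw)) ?szl//.
  rewrite -state_sum_linear; apply: (state_sum_ext wfD) => t tk.
  rewrite /cross_op /cup_op; congr (_ + _); rewrite -mulrA; congr (_ * _).
  by rewrite vw ?size_remove2 ?tk// mulrCA.
Qed.

End Run.

(** * Growth of the bracket of cables *)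

Lemma well_formed_cups (k a m : nat) b D : (a <= k)%N ->
  well_formed (k + m.*2) D ->
  well_formed k ([seq Cup (a + j)%N b | j <- iota 0 m] ++ D).
Proof.
rewrite -{1}(addn0 a); elim: m k 0%N => [|m IH] k j ajk wfD /=.
  by rewrite addn0 in wfD.
by rewrite ajk IH ?addnS ?ltnS ?(leq_trans ajk)// !addSn -!addnS -doubleS.
Qed.

Lemma well_formed_caps (k a m : nat) D : (a + m.*2 <= k)%N ->
  well_formed (k - m.*2) D ->
  well_formed k ([seq Cap (a + j)%N | j <- rev (iota 0 m)] ++ D).
Proof.
elim: m k => [|m IH] k amk wfD; first by rewrite subn0 in wfD.
rewrite -addn1 iotaD rev_cat map_cat /=; apply/andP; split; first by lia.
by apply: IH; [lia|rewrite -subnDA addnC addn2 -doubleS].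
Qed.

Lemma well_formed_crossings (k : nat) (s : seq nat) b D :
  all (fun i => i.+1 < k)%N s -> well_formed k D ->
  well_formed k ([seq Cross i b | i <- s] ++ D).
Proof. by move=> + wfD; elim: s => //= i s IH /andP[-> /IH]. Qed.

(** [m] parallel copies of a slice on strands [i], [i+1] only involve the strands
    [i * m, ..., (i + 2) * m - 1]. *)
Lemma well_formed_cable m k D :
  well_formed k D -> well_formed (k * m) (cable m D).
Proof.
elim: D k => [|[i b|i|i s] D IH] k /=; first by move=> /eqP->.
- case/andP=> ik /IH wfD; rewrite /cable /= well_formed_cups// ?leq_mul2r ?ik ?orbT//.
  by rewrite -mul2n -mulnDl addn2.
- case/andP=> ik /IH wfD; rewrite /cable /= well_formed_caps//.
    by rewrite -mul2n -mulnDl leq_mul2r; apply/orP; right; lia.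
  by rewrite -mul2n -mulnBl.
- case/andP=> ik /IH wfD; rewrite /cable /=.
  rewrite -(map_allpairs (Cross^~ s)); apply: well_formed_crossings => //.
  apply/allP => _ /allpairsP[[j l] /= [+ + ->]].
  rewrite mem_rev !mem_iota !add0n => jm lm; nia.
Qed.

Lemma closed_diagram_well_formed o D :
  closed_diagram o D -> well_formed (size o) D.
Proof.
elim: D o => [|[i b|i|i s] D IH] o //=.
- by case/andP=> io /IH; rewrite io size_insert2.
- by case/and3P=> io _ /IH; rewrite io size_remove2.
- case/andP=> io /IH; rewrite io size_insert2 size_remove2//; last by lia.
  by rewrite -(_ : size o = (size o - 2).+2)//; lia.
Qed.

Lemma well_formed_zero_framed (K : knot) : well_formed 0 (zero_framed K).
Proof.
case: K => D /= /andP[/closed_diagram_well_formed /= wfD _].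
case: D wfD => [|[[|i] b|i|i s] D] //= wfD.
by elim: `|_|%N => //= m ->.
Qed.

Section StateSumBound.
Variables (R : realType) (A : R[i]) (kappa : R).
Hypothesis A_le2 : modulus A <= 2.
Hypothesis AV_le2 : modulus A^-1 <= 2.
Hypothesis A_neq0 : A != 0.
Hypothesis A_kappa : modulus A + modulus (A^-1 - A ^+ 3) <= kappa.
Hypothesis AV_kappa : modulus A^-1 + modulus (A - A ^- 3) <= kappa.

(** An upper bound of the l1-norm of the rows of the matrix by which the slice
    acts, hence of its operator norm for the sup-norm of tensors. *)
Definition slice_cost (x : slice) : R :=
  match x with Cup _ _ => 2 | Cap _ => 4 | Cross _ _ => kappa end.

Lemma modulus_cup_weight b c : modulus (cup_weight A b c) <= 2.
Proof.
by rewrite /cup_weight; case: b c => -[] /=; rewrite ?modulus0 ?modulusN.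
Qed.

Lemma insert2_remove2 (s : seq bool) i : (i.+1 < size s)%N ->
  s = insert2 i (nth true s i) (nth true s i.+1) (remove2 i s).
Proof.
move=> is_; rewrite /insert2 /remove2.
have szi : size (take i s) = i by rewrite size_takel; lia.
rewrite take_cat drop_cat szi ltnn subnn take0 drop0 cats0.
exact: take2_drop.
Qed.

(** On two strands in equal states a crossing is a scalar.  On the states [01] and
    [10] its matrix has the off-diagonal entries of the scaled transposition
    and one diagonal entry, [A^-1 - A^3] or [A - A^-3], which vanishes at
    [A = 1]. *)
Lemma modulus_cross_op (b : bool) i v (s : seq bool) B : (i.+1 < size s)%N ->
  (forall t, size t = size s -> modulus (v t) <= B) ->
  modulus (cross_op A (if b then A else A^-1) i v s) <= kappa * B.
Proof.
move=> is_ vB.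
have B0 : 0 <= B by apply: le_trans (vB s erefl); exact: modulus_ge0.
have key x y t u : size t = size s -> size u = size s ->
    modulus x + modulus y <= kappa -> modulus (x * v t + y * v u) <= kappa * B.
  move=> ts us xy; apply: le_trans (modulusD _ _) _; rewrite !modulusM.
  apply: (@le_trans _ _ (modulus x * B + modulus y * B)).
    by apply: lerD; apply: ler_wpM2l; rewrite ?modulus_ge0 ?vB.
  by rewrite -mulrDl ler_wpM2r.
have sz c d : size (insert2 i c d (remove2 i s)) = size s.
  by rewrite size_insert2 size_remove2//; lia.
have kA : modulus A <= kappa.
  by apply: le_trans A_kappa; rewrite lerDl modulus_ge0.
have kAV : modulus A^-1 <= kappa.
  by apply: le_trans AV_kappa; rewrite lerDl modulus_ge0.
rewrite /cross_op /cup_op /cap_op !big_bool /=.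
rewrite {1}(insert2_remove2 is_) /cup_weight /cap_weight.
have Ds := insert2_remove2 is_; move: Ds (sz true false) (sz false true).
move: (nth _ _ i) (nth _ _ i.+1) (remove2 i s) => c d s' Ds sz10 sz01.
case: (eqVneq c d) => [_|cd].
  rewrite mul0r mulr0 addr0 modulusM.
  apply: ler_pM; rewrite ?modulus_ge0 ?vB -?Ds//; by case: b.
have sB e f : modulus (v (insert2 i e f s')) <= B -> True by [].
move: c d cd Ds => [] [] // _ Ds; rewrite -?Ds; case: b => /=.
- rewrite (_ : _ + _ = A^-1 * v (insert2 i false true s') + 0 * v s).
    by apply: key; rewrite ?modulus0 ?addr0.
  by rewrite Ds; field.
- rewrite (_ : _ + _ = A * v (insert2 i false true s') + (A^-1 - A ^+ 3) * v s).
    exact: key.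
  by rewrite Ds; field.
- rewrite (_ : _ + _ = A^-1 * v (insert2 i true false s') + (A - A ^- 3) * v s).
    exact: key.
  by rewrite Ds; field.
- rewrite (_ : _ + _ = A * v (insert2 i true false s') + 0 * v s).
    by apply: key; rewrite ?modulus0 ?addr0.
  by rewrite Ds; field.
Qed.

Lemma modulus_state_sum v k D B : well_formed k D ->
  (forall t, size t = k -> modulus (v t) <= B) ->
  modulus (state_sum A v D) <= B * \prod_(x <- D) slice_cost x.
Proof.
elim: D v k B => [|[i b|i|i b] D IH] v k B /=.
- by move=> /eqP-> vB; rewrite big_nil mulr1 vB.
- case/andP=> ik wfD vB; rewrite big_cons mulrA /=.
  apply: IH wfD _ => t tk; rewrite /cup_op modulusM mulrC.
  apply: ler_pM; rewrite ?modulus_ge0 ?modulus_cup_weight// vB//.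
  by rewrite size_remove2 tk// subSS subSS subn0.
- case/andP=> ik wfD vB; rewrite big_cons mulrA /=.
  apply: IH wfD _ => t tk; rewrite /cap_op !big_bool /=.
  have wB c d : modulus (v (insert2 i c d t)) <= B.
    by apply: vB; rewrite size_insert2 tk; lia.
  rewrite /cap_weight /= !mul0r add0r addr0.
  apply: le_trans (modulusD _ _) _; rewrite !modulusM modulusN.
  rewrite (_ : B * 4 = 2 * B + 2 * B); last by ring.
  by apply: lerD; apply: ler_pM; rewrite ?modulus_ge0.
- case/andP=> ik wfD vB; rewrite big_cons mulrA /=.
  apply: IH wfD _ => t tk; rewrite [B * _]mulrC.
  by apply: modulus_cross_op; rewrite tk.
Qed.

Lemma modulus_bracket D : well_formed 0 D ->
  modulus (bracket A [::] D) <= \prod_(x <- D) slice_cost x.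
Proof.
move=> wfD; pose v (s : seq bool) : R[i] := 1.
rewrite (@bracket_state_sum _ _ A_neq0 _ v) //; last exact: MatchingNil.
rewrite -[leRHS]mul1r; apply: modulus_state_sum wfD _ => t _.
by rewrite modulus1.
Qed.

(** The [m]-th root of the cost of the [m]-cable of a slice: a crossing is replaced
    by [m^2] crossings, a cup by only [m] cups. *)
Definition cable_cost (m : nat) (x : slice) : R :=
  match x with Cup _ _ => 2 | Cap _ => 4 | Cross _ _ => kappa ^+ m end.

Lemma modulus_bracket_cable m D : well_formed 0 D ->
  modulus (bracket A [::] (cable m D)) <= (\prod_(x <- D) cable_cost m x) ^+ m.
Proof.
move=> wfD; apply: le_trans (modulus_bracket _) _.
  by rewrite -(mul0n m) well_formed_cable.
rewrite le_eqVlt; apply/orP; left; apply/eqP; rewrite /cable big_flatten /=.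
rewrite big_map /= -prodrXl; apply: eq_bigr => -[i b|i|i b] _ /=.
- by rewrite big_map big_const_seq count_predT size_iota iter_mulr_1.
- by rewrite big_map big_const_seq count_predT size_rev size_iota iter_mulr_1.
- rewrite -exprM -(map_allpairs (Cross^~ b)) big_map big_const_seq count_predT.
  by rewrite size_allpairs size_rev size_iota iter_mulr_1.
Qed.

End StateSumBound.

(** * Specialization of identities between Laurent polynomials *)

Section LaurentMap.

(** An expression in the variable [x] that is given, over all fields at once, by
    one Laurent polynomial with integer coefficients.  Identities between such
    expressions at the generic point [genvar] hold everywhere. *)
Definition laurent_map (f : forall F : fieldType, F -> F) : Prop :=
  exists (p : {poly int}) (s : nat), forall (F : fieldType) (x : F), x != 0 ->
    f F x * x ^+ s = (map_poly intr p).[x].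

Lemma laurent_map_int (c : int) : laurent_map (fun F x => c%:~R).
Proof.
by exists c%:P, 0%N => F x x0; rewrite mulr1 map_polyC hornerC.
Qed.

Lemma laurent_map_id : laurent_map (fun F x => x).
Proof. by exists 'X, 0%N => F x x0; rewrite mulr1 map_polyX hornerX. Qed.

Lemma laurent_map_inv : laurent_map (fun F x => x^-1).
Proof. by exists 1, 1%N => F x x0; rewrite mulVf// rmorph1 hornerC. Qed.

Lemma laurent_mapD f g : laurent_map f -> laurent_map g ->
  laurent_map (fun F x => f F x + g F x).
Proof.
move=> [p [s fp]] [q [t gq]]; exists (p * 'X^t + q * 'X^s), (s + t)%N => F x x0.
rewrite rmorphD !rmorphM /= !map_polyXn hornerD !hornerM !hornerXn -fp// -gq//.
by rewrite exprD; ring.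
Qed.

Lemma laurent_mapM f g : laurent_map f -> laurent_map g ->
  laurent_map (fun F x => f F x * g F x).
Proof.
move=> [p [s fp]] [q [t gq]]; exists (p * q), (s + t)%N => F x x0.
by rewrite rmorphM hornerM -fp// -gq// exprD; ring.
Qed.

Lemma laurent_mapN f : laurent_map f -> laurent_map (fun F x => - f F x).
Proof.
move=> [p [s fp]]; exists (- p), s => F x x0.
by rewrite rmorphN hornerN -fp// mulNr.
Qed.

Lemma laurent_mapX f n : laurent_map f -> laurent_map (fun F x => f F x ^+ n).
Proof.
move=> [p [s fp]]; exists (p ^+ n), (s * n)%N => F x x0.
by rewrite rmorphXn horner_exp -fp// exprMn exprM.
Qed.

Lemma laurent_map_horner f (p : {poly int}) : laurent_map f ->
  laurent_map (fun F x => (map_poly intr p).[f F x]).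
Proof.
move=> fL; elim/poly_ind: p => [|p c [q [s IH]]].
  by exists 0, 0%N => F x x0; rewrite rmorph0 !horner0 mul0r.
have [q' [s' IH']] :=
  laurent_mapD (laurent_mapM (ex_intro _ q (ex_intro _ s IH)) fL) (laurent_map_int c).
exists q', s' => F x x0; rewrite -IH'//; congr (_ * _).
by rewrite rmorphD rmorphM /= map_polyX map_polyC hornerMXaddC.
Qed.

Lemma laurent_map_sum n (f : nat -> forall F : fieldType, F -> F) :
  (forall i, laurent_map (f i)) ->
  laurent_map (fun F x => \sum_(i < n) f i F x).
Proof.
move=> fL; elim: n => [|n [q [s IH]]].
  by exists 0, 0%N => F x x0; rewrite big_ord0 rmorph0 horner0 mul0r.
have [q' [s' IH']] := laurent_mapD (ex_intro _ q (ex_intro _ s IH)) (fL n).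
by exists q', s' => F x x0; rewrite -IH'// big_ord_recr.
Qed.

Lemma laurent_map_bracket l D : laurent_map (fun F x => bracket x l D).
Proof.
have loopL : laurent_map (fun F x => - x ^+ 2 - x ^- 2).
  have [p [s ps]] := laurent_mapD (laurent_mapN (laurent_mapX 2 laurent_map_id))
     (laurent_mapN (laurent_mapX 2 laurent_map_inv)).
  by exists p, s => F x x0; rewrite -ps// exprVn.
have closeL (b : bool) : laurent_map (fun F x => if b then - x ^+ 2 - x ^- 2 else 1).
  by case: b => //; exact: (laurent_map_int 1).
elim: D l => [|[i b|i|i b] D IH] l /=.
- exact: (laurent_map_int 1).
- exact: IH.
- exact: laurent_mapM.
- apply: laurent_mapD; apply: laurent_mapM => //.
    by case: b; [exact: laurent_map_id|exact: laurent_map_inv].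
  apply: laurent_mapM => //; case: b; first exact: laurent_map_inv.
  have [p [s ps]] := laurent_map_id.
  by exists p, s => F x x0; rewrite -ps// invrK.
Qed.

(** A numerator that vanishes at [genvar] is the zero polynomial. *)
Lemma laurent_map_identity f : laurent_map f ->
  f ratfun genvar = 0 -> forall (F : fieldType) (x : F), x != 0 -> f F x = 0.
Proof.
move=> [p [s fp]] f0.
have genvar0 : genvar != 0 by rewrite tofrac_eq0 polyX_eq0.
suff p0 : p = 0.
  move=> F x x0; have := fp F x x0; rewrite p0 rmorph0 horner0 => /eqP.
  by rewrite mulf_eq0 expf_eq0 (negPf x0) andbF orbF => /eqP.
apply/eqP; rewrite -tofrac_eq0; apply/eqP.
suff <- : (map_poly intr p).[genvar] = tofrac p by rewrite -fp// f0 mul0r.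
elim/poly_ind: p {fp} => [|q c IH]; first by rewrite !rmorph0 horner0.
rewrite !rmorphD !rmorphM /= map_polyX map_polyC hornerMXaddC IH.
by rewrite -[in RHS](intz c) !rmorph_int.
Qed.

End LaurentMap.

Definition cable_bracket_at (F : fieldType) (A : F) (p : {poly int}) D : F :=
  \sum_(m < size p) (p`_m)%:~R * bracket A [::] (cable m D).

Lemma laurent_map_cable_bracket p D :
  laurent_map (fun F x => cable_bracket_at x p D).
Proof.
apply: (@laurent_map_sum _ (fun m F x => (p`_m)%:~R * bracket x [::] (cable m D))).
by move=> i; apply: laurent_mapM; [exact: laurent_map_int|exact: laurent_map_bracket].
Qed.

Lemma laurent_map_levalZ L :
  laurent_map (fun F x => levalZ L (x ^- 4)).
Proof.
have L4 : laurent_map (fun F x => x^-4).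
  have [p [s ps]] := laurent_mapX 4 laurent_map_inv.
  by exists p, s => F x x0; rewrite -ps// exprVn.
have L4V : laurent_map (fun F x => (x ^- 4 ^+ Defs.lshift L)^-1).
  have [p [s ps]] := laurent_mapX (Defs.lshift L) (laurent_mapX 4 laurent_map_id).
  by exists p, s => F x x0; rewrite -ps// exprVn invrK.
apply: laurent_mapM => //.
exact: laurent_map_horner.
Qed.

(** The quotient in [is_colored_jones] belongs to a field of rational functions;
    clearing its denominator gives an identity of Laurent polynomials, which can
    be evaluated. *)
Lemma colored_jones_at K n J (F : fieldType) (A : F) :
  is_colored_jones K n J -> A != 0 ->
  cable_bracket_at A (Defs.chebyshev n.-1) unknot_diagram != 0 ->
  levalZ J (A ^- 4) * cable_bracket_at A (Defs.chebyshev n.-1) unknot_diagram =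
  cable_bracket_at A (Defs.chebyshev n.-1) (zero_framed K).
Proof.
move=> Jn A0 U0.
have UL := laurent_map_cable_bracket (Defs.chebyshev n.-1) unknot_diagram.
have KL := laurent_map_cable_bracket (Defs.chebyshev n.-1) (zero_framed K).
have Ugen : cable_bracket (Defs.chebyshev n.-1) unknot_diagram != 0.
  apply: contra_neq U0 => U0; exact: (laurent_map_identity UL).
apply/eqP; rewrite -subr_eq0; apply/eqP.
have JL := laurent_mapD (laurent_mapM (laurent_map_levalZ J) UL) (laurent_mapN KL).
apply: (laurent_map_identity JL) => //.
rewrite Jn; apply/eqP; rewrite subr_eq0; apply/eqP.
exact: divfK.
Qed.

(** * Series that converge at a geometric rate *)

Section GeometricConvergence.
Variable R : realType.
Implicit Types (u : nat -> R[i]) (w : R[i]) (theta q C : R).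

(** The value [w] is given in advance: this is an estimate and not an existence
    statement. *)
Definition converges_at_rate theta u w : Prop :=
  exists C, forall n, modulus (w - \sum_(j < n) u j) <= C * theta ^+ n.

Definition cauchy_product u v : nat -> R[i] :=
  fun n => \sum_(i < n.+1) u i * v (n - i)%N.

Lemma geometric_sum_le q m : 0 <= q <= 1 / 2 -> \sum_(j < m) q ^+ j <= 2.
Proof.
move=> /andP[q0 q2].
(* The stronger induction hypothesis 2 - 2 q^m survives since 2 q <= 1. *)
suff : \sum_(j < m) q ^+ j <= 2 - 2 * q ^+ m.
  by have := exprn_ge0 m q0; lra.
elim: m => [|m IH]; first by rewrite big_ord0 expr0; lra.
rewrite big_ord_recr /= exprSr; have := exprn_ge0 m q0.
by move: IH; nra.
Qed.

Lemma sum_modulus_tail u C q n m : 0 <= q <= 1 / 2 ->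
  (forall j, modulus (u j) <= C * q ^+ j) ->
  modulus (\sum_(j < m) u (n + j)%N) <= 2 * C * q ^+ n.
Proof.
move=> q2 uC; have C0 : 0 <= C.
  by apply: le_trans (modulus_ge0 _) (le_trans (uC 0%N) _); rewrite expr0 mulr1.
apply: le_trans (modulus_sum _ _ _) _.
apply: (@le_trans _ _ (\sum_(j < m) C * q ^+ n * q ^+ j)).
  by apply: ler_sum => j _; rewrite -mulrA -exprD.
rewrite -mulr_sumr (_ : 2 * C * q ^+ n = C * q ^+ n * 2); last by ring.
apply: ler_wpM2l; last exact: geometric_sum_le.
by rewrite mulr_ge0// exprn_ge0//; case/andP: q2.
Qed.

Lemma ler_geometric_error (a b C theta : R) : 0 <= theta < 1 ->
  (forall n, a <= b + C * theta ^+ n) -> a <= b.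
Proof.
move=> /andP[t0 t1] ab; apply/ler_addgt0Pr => e e0.
have cv : (fun n => C * theta ^+ n) @ \oo --> C * 0.
  by apply: cvgMr; apply: cvg_expr; rewrite ger0_norm.
rewrite mulr0 in cv.
have /cvgrPdist_le /(_ e e0) [n _ /(_ n (leqnn n))] := cv.
rewrite /= sub0r normrN => h; apply: le_trans (ab n) _.
by rewrite lerD2l (le_trans (ler_norm _)).
Qed.

(** Convergence at some rate identifies the sum, and the size of the terms then
    controls the tails. *)
Lemma sharper_rate theta u w C q : 0 <= theta < 1 -> 0 <= q <= 1 / 2 ->
  converges_at_rate theta u w -> (forall j, modulus (u j) <= C * q ^+ j) ->
  forall n, modulus (w - \sum_(j < n) u j) <= 2 * C * q ^+ n.
Proof.
move=> t01 q2 [C' uw] uC n.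
apply: (@ler_geometric_error _ _ (C' * theta ^+ n) theta t01) => m.
rewrite -[X in _ <= _ + X]mulrA -exprD.
apply: le_trans _ (lerD (sum_modulus_tail n m q2 uC) (uw (n + m)%N)).
apply: le_trans (modulusD _ _); rewrite le_eqVlt; apply/orP; left; apply/eqP.
congr modulus; rewrite big_split_ord /=; ring.
Qed.

Lemma rate_terms theta u w : 0 <= theta -> converges_at_rate theta u w ->
  exists C, forall n, modulus (u n) <= C * theta ^+ n.
Proof.
move=> t0 [C uw]; exists (C + C * theta) => n.
have -> : u n = (w - \sum_(j < n) u j) - (w - \sum_(j < n.+1) u j).
  by rewrite big_ord_recr /=; ring.
apply: le_trans (modulusB _ _) _; rewrite mulrDl -mulrA -exprS.
exact: lerD.
Qed.

Lemma rateD theta u v w w' : converges_at_rate theta u w ->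
  converges_at_rate theta v w' ->
  converges_at_rate theta (fun j => u j + v j) (w + w').
Proof.
move=> [C uw] [C' vw]; exists (C + C') => n; rewrite mulrDl.
apply: le_trans (lerD (uw n) (vw n)); apply: le_trans (modulusD _ _).
rewrite big_split /= le_eqVlt; apply/orP; left; apply/eqP; congr modulus; ring.
Qed.

Lemma rateZ theta u w c : converges_at_rate theta u w ->
  converges_at_rate theta (fun j => c * u j) (c * w).
Proof.
move=> [C uw]; exists (modulus c * C) => n.
rewrite -mulr_sumr -mulrBr modulusM -mulrA.
by rewrite ler_wpM2l ?modulus_ge0.
Qed.

Lemma rate_sum theta (m : nat) (u : nat -> nat -> R[i]) (w : nat -> R[i]) :
  (forall i, converges_at_rate theta (u i) (w i)) ->
  converges_at_rate theta (fun j => \sum_(i < m) u i j) (\sum_(i < m) w i).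
Proof.
move=> uw; elim: m => [|m IH].
  exists 0 => n; rewrite big_ord0 big1 ?subr0 ?modulus0 ?mul0r// => j _.
  by rewrite big_ord0.
have [C' h] := rateD IH (uw m); exists C' => n.
rewrite big_ord_recr /=; under [X in _ - X]eq_bigr do rewrite big_ord_recr /=.
exact: h.
Qed.

Lemma sum_cauchy_product u v n :
  \sum_(k < n) cauchy_product u v k = \sum_(i < n) u i * \sum_(j < n - i) v j.
Proof.
elim: n => [|n IH]; first by rewrite !big_ord0.
rewrite big_ord_recr /= IH [RHS]big_ord_recr /= subSnn big_ord1.
rewrite /cauchy_product big_ord_recr /= subnn addrA -big_split /=.
congr (_ + _); apply: eq_bigr => i _; rewrite -mulrDr subSn ?(ltnW (ltn_ord i))//.
by rewrite big_ord_recr.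
Qed.

(** The slower factor determines the rate of the Cauchy product; the factor 2
    between the rates makes the sum of the cross terms geometric. *)
Lemma rateM theta u v w w' : 0 < theta ->
  converges_at_rate (theta / 2) u w -> converges_at_rate theta v w' ->
  converges_at_rate theta (cauchy_product u v) (w * w').
Proof.
move=> t0 uw vw'; have t2 : 0 <= theta / 2 by lra.
have [C1 uC1] := rate_terms t2 uw.
case: uw => C uw; case: vw' => C' vw'.
have C0 : 0 <= C by have := le_trans (modulus_ge0 _) (uw 0%N); rewrite mulr1.
have C'0 : 0 <= C' by have := le_trans (modulus_ge0 _) (vw' 0%N); rewrite mulr1.
have C10 : 0 <= C1 by have := le_trans (modulus_ge0 _) (uC1 0%N); rewrite mulr1.
exists (C * modulus w' + 2 * C1 * C') => n; rewrite sum_cauchy_product.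
rewrite (_ : _ - _ = (w - \sum_(j < n) u j) * w' +
    \sum_(i < n) u i * (w' - \sum_(j < n - i) v j)); last first.
  under [X in _ = _ + X]eq_bigr do rewrite mulrBr.
  by rewrite sumrB -mulr_suml; ring.
apply: le_trans (modulusD _ _) _; rewrite [leRHS]mulrDl; apply: lerD.
  rewrite modulusM mulrAC ler_wpM2r ?modulus_ge0//.
  apply: le_trans (uw n) _; apply: ler_wpM2l => //.
  by apply: lerXn2r; rewrite ?nnegrE; lra.
apply: le_trans (modulus_sum _ _ _) _.
apply: (@le_trans _ _ (\sum_(i < n) C1 * C' * theta ^+ n * (1 / 2) ^+ i)).
  apply: ler_sum => i _; rewrite modulusM.
  rewrite (_ : _ * _ * _ = (C1 * (theta / 2) ^+ i) * (C' * theta ^+ (n - i))).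
    by apply: ler_pM; rewrite ?modulus_ge0.
  rewrite -{1}(subnK (ltnW (ltn_ord i))) exprD mul1r exprMn; ring.
rewrite -mulr_sumr (_ : 2 * C1 * C' * theta ^+ n = C1 * C' * theta ^+ n * 2); last by ring.
apply: ler_wpM2l; first by rewrite !mulr_ge0// exprn_ge0// ltW.
by apply: geometric_sum_le; lra.
Qed.

Lemma exp_term_bound (t theta : R) : 0 <= t -> 0 < theta ->
  exists C, forall j, t ^+ j / j`!%:R <= C * theta ^+ j.
Proof.
move=> t0 th0; exists (1 + expR (t / theta)) => j.
have E : t ^+ j / j`!%:R = (t / theta) ^+ j / j`!%:R * theta ^+ j.
  rewrite mulrAC -exprMn divfK//; lra.
rewrite E ler_wpM2r ?exprn_ge0 ?(ltW th0)//.
have tt : 0 <= t / theta by rewrite divr_ge0// ltW.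
case: j {E} => [|j]; first by rewrite expr0 divr1 lerDl expR_ge0.
by have := expR_ge1Dxn j tt; have := expR_ge0 (t / theta); lra.
Qed.

Lemma real_rate (u : nat -> R) (l C theta : R) : 0 <= theta <= 1 / 2 ->
  (forall j, `|u j| <= C * theta ^+ j) -> series u @ \oo --> l ->
  converges_at_rate theta (fun j => (u j)%:C%C) l%:C%C.
Proof.
move=> th uC ul; exists (2 * C) => n.
have -> : l%:C%C - \sum_(j < n) (u j)%:C%C = (l - \sum_(j < n) u j)%:C%C.
  by rewrite rmorphB rmorph_sum.
rewrite modulus_real; apply/ler_addgt0Pr => e e0.
have /cvgrPdist_le /(_ e e0) [m _ /(_ (n + m)%N (leq_addl _ _))] := ul.
rewrite /= /series /= big_mkord big_split_ord /= opprD addrA => h.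
have uC' j : modulus ((u j)%:C)%C <= C * theta ^+ j by rewrite modulus_real.
have := sum_modulus_tail n m th uC'; rewrite -rmorph_sum /= modulus_real => h'.
rewrite [leRHS]addrC; apply: le_trans _ (lerD h h').
apply: le_trans (ler_normD _ _); rewrite le_eqVlt; apply/orP; left; apply/eqP.
by congr Num.norm; ring.
Qed.

Lemma expR_rate (x theta : R) : 0 < theta <= 1 / 2 ->
  converges_at_rate theta (fun j => x%:C%C ^+ j / j`!%:R) (expR x)%:C%C.
Proof.
move=> /andP[t0 t2]; have [C xC] := exp_term_bound (normr_ge0 x) t0.
have [|||C' h] := @real_rate (exp_coeff x) (expR x) C theta.
- by rewrite ltW.
- move=> j; rewrite /exp_coeff /= normrM normfV normrX normr_nat; exact: xC.
- exact: is_cvg_series_exp_coeff.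
exists C' => n; apply: le_trans (h n); rewrite le_eqVlt; apply/orP; left; apply/eqP.
congr (modulus (_ - _)); apply: eq_bigr => j _; rewrite /exp_coeff /=.
by rewrite fmorph_div rmorphXn rmorph_nat.
Qed.

(** Euler's formula at the level of partial sums: the terms of even and odd degree
    are those of the cosine and sine series. *)
Lemma trigo_rate (y theta : R) : 0 < theta <= 1 / 2 ->
  converges_at_rate theta (fun j => (Complex 0 y) ^+ j / j`!%:R)
    (Complex (cos y) (sin y)).
Proof.
move=> /andP[t0 t2]; have [C yC] := exp_term_bound (normr_ge0 y) t0.
have th : 0 <= theta <= 1 / 2 by rewrite ltW.
have C0 j : 0 <= C * theta ^+ j.
  by apply: le_trans (yC j); rewrite mulr_ge0// exprn_ge0.
have cosP : converges_at_rate theta (fun j => (cos_coeff y j)%:C%C) (cos y)%:C%C.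
  apply: (real_rate th (C := C)); last first.
    by rewrite cos.unlock; exact: is_cvg_series_cos_coeff.
  move=> j; rewrite /cos_coeff /= !normrM normfV normr_sign normrX !normr_nat mulr1.
  case: (odd j); last by rewrite mul1r.
  by rewrite mul0r mul0r.
have sinP : converges_at_rate theta (fun j => (sin_coeff y j)%:C%C) (sin y)%:C%C.
  apply: (real_rate th (C := C)); last first.
    by rewrite sin.unlock; exact: is_cvg_series_sin_coeff.
  move=> j; rewrite /sin_coeff /= !normrM normfV normr_sign normrX !normr_nat mulr1.
  case: (odd j); first by rewrite mul1r.
  by rewrite mul0r mul0r.
have [C' h] := rateD cosP (rateZ (Complex 0 1) sinP); exists C' => n.
apply: le_trans (h n); rewrite le_eqVlt; apply/orP; left; apply/eqP.
congr (modulus (_ - _)).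
  by apply/eqP; rewrite eq_complex /=; apply/andP; split; apply/eqP; ring.
apply: eq_bigr => j _.
have Ey : Complex 0 y = Complex 0 1 * y%:C%C.
  by apply/eqP; rewrite eq_complex /=; apply/andP; split; apply/eqP; ring.
have i2 : (Complex 0 1 : R[i]) ^+ 2 = -1.
  by apply/eqP; rewrite eq_complex /=; apply/andP; split; apply/eqP; ring.
rewrite Ey exprMn /cos_coeff /sin_coeff /=.
rewrite -{1}(odd_double_half j) exprD -mul2n exprM i2.
case jo : (odd j) => /=.
  have -> : j.-1./2 = j./2.
    by rewrite -{1}(odd_double_half j) jo add1n /= doubleK.
  rewrite !mul0r add0r expr1 mul1r !rmorphM /= fmorphV !rmorphXn /= rmorphN1 rmorph_nat.
  by ring.
rewrite !mul0r mulr0 addr0 expr0 !mul1r !rmorphM /= fmorphV !rmorphXn /= rmorphN1 rmorph_nat.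
by ring.
Qed.

Lemma cexp_rate (z : R[i]) theta : 0 < theta <= 1 / 2 ->
  converges_at_rate theta (fun j => z ^+ j / j`!%:R) (cexp z).
Proof.
move=> /andP[t0 t2]; case: z => x y; rewrite /cexp /=.
have [||C h] := rateM t0 (@expR_rate x (theta / 2) _) (@trigo_rate y theta _); [lra..|].
exists C => n; apply: le_trans (h n); rewrite le_eqVlt; apply/orP; left; apply/eqP.
congr (modulus (_ - _)).
  by apply/eqP; rewrite eq_complex /=; apply/andP; split; apply/eqP; ring.
apply: eq_bigr => k _; rewrite /cauchy_product.
have -> : (Complex x y : R[i]) = Complex 0 y + x%:C%C.
  by apply/eqP; rewrite eq_complex /=; apply/andP; split; apply/eqP; ring.
rewrite exprDn mulr_suml; apply: eq_bigr => i _.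
have ik : (i <= k)%N by rewrite -ltnS.
rewrite -(bin_fact ik) !natrM -mulr_natr.
have f0 m : m`!%:R != 0 :> R[i] by rewrite pnatr_eq0 -lt0n fact_gt0.
have b0 : 'C(k, i)%:R != 0 :> R[i] by rewrite pnatr_eq0 -lt0n bin_gt0.
by field; rewrite !f0 b0.
Qed.

End GeometricConvergence.

(** * The complex exponential and the Cauchy estimate *)

Section ComplexExponential.
Variable R : realType.
Implicit Types (z w : R[i]).

Lemma cexpD z w : cexp (z + w) = cexp z * cexp w.
Proof.
case: z w => [x y] [x' y']; rewrite /cexp /= expRD sinD cosD.
by apply/eqP; rewrite eq_complex /=; apply/andP; split; apply/eqP; ring.
Qed.

Lemma cexp0 : cexp 0 = 1 :> R[i].
Proof.
rewrite /cexp /= expR0 cos0 sin0.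
by apply/eqP; rewrite eq_complex /=; apply/andP; split; apply/eqP; ring.
Qed.

Lemma cexpN z : cexp (- z) = (cexp z)^-1.
Proof.
have e1 : cexp (- z) * cexp z = 1 by rewrite -cexpD addNr cexp0.
have ez : cexp z != 0.
  by apply: contra_eq_neq e1 => ->; rewrite mulr0 eq_sym oner_neq0.
by apply: (mulIf ez); rewrite e1 mulVf.
Qed.

Lemma cexp_neq0 z : cexp z != 0.
Proof.
have : cexp (- z) * cexp z != 0 by rewrite -cexpD addNr cexp0 oner_neq0.
by rewrite mulf_eq0 negb_or => /andP[].
Qed.

Lemma cexpX z n : cexp z ^+ n = cexp (n%:R * z).
Proof.
elim: n => [|n IH]; first by rewrite mul0r cexp0.
by rewrite exprS IH -cexpD -natr1 mulrDl mul1r addrC.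
Qed.

Lemma cexp_taylor z n : modulus z <= 1 / 2 ->
  modulus (cexp z - \sum_(j < n) z ^+ j / j`!%:R) <= 2 * modulus z ^+ n.
Proof.
move=> z2; rewrite -[2](mulr1 2).
apply: (@sharper_rate _ (1 / 2) (fun j => z ^+ j / j`!%:R)); first by lra.
- by rewrite modulus_ge0.
- by apply: cexp_rate; lra.
- move=> j; rewrite mul1r modulusM modulusX modulusV modulus_nat.
  rewrite ler_piMr ?exprn_ge0 ?modulus_ge0// invf_le1 ?ltr0n ?fact_gt0//.
  by rewrite ler1n fact_gt0.
Qed.

Lemma modulus_cexp_sub1 z : modulus z <= 1 / 2 ->
  modulus (cexp z - 1) <= 2 * modulus z.
Proof.
move=> /(@cexp_taylor _ 1); rewrite big_ord_recl big_ord0 addr0.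
by rewrite expr0 divr1 expr1.
Qed.

Lemma modulus_cexp_sub1X z : modulus z <= 1 / 2 ->
  modulus (cexp z - 1 - z) <= 2 * modulus z ^+ 2.
Proof.
move=> /(@cexp_taylor _ 2); rewrite !big_ord_recl big_ord0 addr0.
by rewrite expr0 !divr1 expr1 opprD addrA.
Qed.

End ComplexExponential.

Section CauchyEstimate.
Variable R : realType.

(** Iterated square roots of [-1]. *)
Lemma two_power_root t : exists x : R[i], (2 ^ t.+1).-primitive_root x.
Proof.
have [x xt] : exists x : R[i], x ^+ (2 ^ t) = -1.
  elim: t => [|t [x xt]]; first by exists (-1); rewrite expn0 expr1.
  by exists (sqrtC x); rewrite expnS exprM sqrtCK.
exists x; have x1 : x ^+ (2 ^ t.+1) = 1.
  by rewrite expnSr exprM xt sqrrN expr1n.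
have [|m xm mt] := @prim_order_exists _ (2 ^ t.+1) x _ x1.
  by rewrite expn_gt0.
(* The order of x divides 2^(t+1) and x^(2^t) = -1 excludes the proper divisors. *)
have /(dvdn_pfactor _ _ (isT : prime 2)) [s st Dm] := mt.
move: st; rewrite leq_eqVlt ltnS => /orP[/eqP<-|st]; first by rewrite -Dm.
have : x ^+ (2 ^ t) = 1.
  by rewrite -(subnK st) addnC expnD exprM -Dm (prim_expr_order xm) expr1n.
by rewrite xt => /eqP; rewrite eq_sym -addr_eq0 -mulr2n pnatr_eq0.
Qed.

Lemma modulus_root1 (x : R[i]) n : (0 < n)%N -> x ^+ n = 1 -> modulus x = 1.
Proof.
move=> n0 xn; apply/eqP; rewrite -(pexpr_eq1 n0) ?modulus_ge0//.
by rewrite -modulusX xn modulus1.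
Qed.

(** Orthogonality of the characters of the group of [L]-th roots of unity. *)
Lemma average_roots (L m : nat) (x : R[i]) (a : nat -> R[i]) :
  L.-primitive_root x -> (m < L)%N ->
  \sum_(k < L) x ^- (k * m) * (\sum_(j < L) a j * x ^+ (k * j)) = L%:R * a m.
Proof.
move=> xL mL; have L0 := prim_order_gt0 xL.
have x0 : x != 0 by rewrite -modulus_gt0 (modulus_root1 L0 (prim_expr_order xL)) ltr01.
under eq_bigr do rewrite mulr_sumr.
rewrite exchange_big /= (bigD1 (Ordinal mL)) //= [X in _ + X]big1 => [|j jm].
  rewrite addr0 (eq_bigr (fun=> a m)) => [|k _].
    by rewrite sumr_const card_ord mulr_natl.
  by rewrite mulrC mulfK// expf_neq0.
under eq_bigr => k _ do rewrite mulrCA -![(k * _)%N]mulnC !exprM -exprVn -exprMn.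
rewrite -mulr_sumr; apply/eqP; rewrite mulf_eq0; apply/orP; right.
set y := _ * _.
have y1 : y - 1 != 0.
  rewrite subr_eq0 /y mulrC -(inj_eq (mulIf (expf_neq0 m x0))) mul1r divfK ?expf_neq0//.
  rewrite (eq_prim_root_expr xL) !modn_small//.
have := subrX1 y L; rewrite {1}/y exprMn exprVn -!exprM ![(_ * L)%N]mulnC !exprM.
rewrite (prim_expr_order xL) !expr1n invr1 mulr1 subrr => /esym/eqP.
by rewrite mulf_eq0 (negPf y1).
Qed.

(** The integral over the circle is replaced by the average over the [L]-th roots of
    unity, which isolates the coefficient [a m] up to an error given by the
    terms of degree at least [L], and [L] is arbitrarily large. *)
Lemma cauchy_estimate (f : R[i] -> R[i]) (a : nat -> R[i]) (r B : R) m :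
  0 <= r -> (forall z, modulus z = r -> modulus (f z) <= B) ->
  (forall z, modulus z = r -> converges_at_rate (1 / 2) (fun j => a j * z ^+ j) (f z)) ->
  modulus (a m) * r ^+ m <= B.
Proof.
move=> r0 fB fa; pose rc : R[i] := r%:C%C.
have mr : modulus rc = r by rewrite modulus_real ger0_norm.
have [C aC] := rate_terms (ltW (ltac:(lra) : 0 < 1 / 2 :> R)) (fa rc mr).
apply: (@ler_geometric_error _ _ _ (2 * C) (1 / 2)) => [|n]; first by lra.
have [x xL] := two_power_root (m + n); set L := (2 ^ _)%N in xL.
have mL : (m + n < L)%N by rewrite /L (ltn_trans (ltnSn _))// ltn_expl.
have L0 := prim_order_gt0 xL.
have mx := modulus_root1 L0 (prim_expr_order xL).
have mxk k : modulus (x ^+ k) = 1 by rewrite modulusX mx expr1n.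
pose p k := \sum_(j < L) a j * rc ^+ j * x ^+ (k * j).
have pB k : modulus (p k) <= B + 2 * C * (1 / 2) ^+ n.
  pose z := rc * x ^+ k; have mz : modulus z = r by rewrite modulusM mr mxk mulr1.
  have -> : p k = f z - (f z - p k) by ring.
  apply: le_trans (modulusB _ _) _; apply: lerD; first exact: fB.
  apply: (@le_trans _ _ (2 * C * (1 / 2) ^+ L)).
    have pz : p k = \sum_(j < L) a j * z ^+ j.
      by apply: eq_bigr => j _; rewrite /z exprMn -exprM mulrA.
    rewrite pz; apply: (sharper_rate _ _ (fa z mz)); [lra|lra|move=> j].
    apply: le_trans (aC j); rewrite !modulusM /z exprMn !modulusM !modulusX.
    by rewrite mx !expr1n mulr1.
  have C0 : 0 <= C by have := le_trans (modulus_ge0 _) (aC 0%N); rewrite mulr1.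
  apply: ler_wpM2l; first by lra.
  apply: ler_wiXn2l; [lra|lra|].
  by rewrite ltnW// (leq_ltn_trans (leq_addl _ _) mL).
have mL' := leq_ltn_trans (leq_addr n m) mL.
have := average_roots (fun j => a j * rc ^+ j) xL mL'.
move=> /(congr1 (@modulus R)); rewrite !modulusM modulus_nat modulusX mr => E.
rewrite -(ler_pM2l (_ : 0 < L%:R)) ?ltr0n// -E.
apply: le_trans (modulus_sum _ _ _) _.
apply: (@le_trans _ _ (\sum_(k < L) (B + 2 * C * (1 / 2) ^+ n))).
  apply: ler_sum => k _; rewrite modulusM modulusV mxk invr1 [leLHS]mul1r; exact: pB.
by rewrite sumr_const card_ord [leRHS]mulr_natl.
Qed.

End CauchyEstimate.

(** * Cables of the unknot and Chebyshev polynomials *)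

Section Unknot.
Variables (F : fieldType) (A : F).

Lemma insert2K (i : nat) (x y : nat) l : (i <= size l)%N ->
  remove2 i (insert2 i x y l) = l.
Proof.
move=> il; rewrite /remove2 /insert2; have szi : size (take i l) = i by rewrite size_takel.
rewrite take_cat szi ltnn subnn take0 cats0 drop_cat szi ltnNge (leq_trans (leqnSn _))//=.
by rewrite subSn// subSnn /= drop0 cat_take_drop.
Qed.

Lemma cap_cup_labels i l : (i <= size l)%N ->
  cap_closes i (cup_labels i l) /\ cap_labels i (cup_labels i l) = l.
Proof.
move=> il; rewrite /cap_closes /cap_labels /cup_labels.
have szi : size (take i l) = i by rewrite size_takel.
set x := _.+1; have n0 : nth 0%N (insert2 i x x l) i = x.
  by rewrite /insert2 nth_cat szi ltnn subnn.
have n1 : nth 0%N (insert2 i x x l) i.+1 = x.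
  by rewrite /insert2 nth_cat szi ltnNge leqnSn /= subSnn.
rewrite n0 n1 eqxx insert2K//; split=> //.
exact: (merge_labels_id x (max_label_notin l)).
Qed.

Lemma bracket_unknot_cable m :
  bracket A [::] (cable m unknot_diagram) = loop_value A ^+ m.
Proof.
pose L := fix L j := if j is j'.+1 then cup_labels j' (L j') else [::].
have szL j : size (L j) = j.*2.
  by elim: j => //= j IH; rewrite size_insert2 IH// -addnn leq_addr.
have cups j D : bracket A (L j) ([seq Cup k true | k <- iota j m] ++ D) =
    bracket A (L (j + m)%N) D.
  elim: m j => [|p IH] j /=; first by rewrite addn0.
  by rewrite -addSnnS -IH.
have caps p : bracket A (L p) [seq Cap k | k <- rev (iota 0 p)] = loop_value A ^+ p.
  elim: p => [|p IH]; first by rewrite expr0.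
  rewrite -addn1 iotaD rev_cat map_cat addn1 /=.
  have [|-> ->] := @cap_cup_labels p (L p); first by rewrite szL -addnn leq_addr.
  by rewrite IH [RHS]exprS.
by rewrite /cable /= cats0; exact: etrans (cups 0%N _) (caps m).
Qed.

Lemma cable_bracket_unknot p :
  cable_bracket_at A p unknot_diagram = (map_poly intr p).[loop_value A].
Proof.
rewrite /cable_bracket_at (horner_coef_wide _ (size_poly _ _)).
by apply: eq_bigr => i _; rewrite bracket_unknot_cable coef_map_id0 ?mulr0z.
Qed.

Lemma chebyshevS m :
  Defs.chebyshev m.+2 = 'X * Defs.chebyshev m.+1 - Defs.chebyshev m.
Proof. by []. Qed.

(** The Chebyshev polynomial at [- (x + x^-1)] is a quantum integer up to sign. *)
Lemma horner_chebyshev (x y : F) m : x * y = 1 ->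
  (map_poly intr (Defs.chebyshev m)).[- (x + y)] =
  (-1) ^+ m * \sum_(j < m.+1) x ^+ (m - j) * y ^+ j.
Proof.
move=> xy; pose s k := \sum_(j < k.+1) x ^+ (k - j) * y ^+ j.
have s1 k : s k.+1 = x ^+ k.+1 + y * s k.
  rewrite /s big_ord_recl /= expr0 mulr1; congr (_ + _).
  by rewrite mulr_sumr; apply: eq_bigr => i _; rewrite /bump /= subSS exprS; ring.
have s2 k : s k.+2 = (x + y) * s k.+1 - s k.
  have sx : x * s k.+1 = x ^+ k.+2 + s k.
    rewrite s1 mulrDr mulrA xy mul1r -exprS //.
  by rewrite [LHS]s1 mulrDl sx; ring.
rewrite -/(s m).
suff : forall k, (map_poly intr (Defs.chebyshev k)).[- (x + y)] = (-1) ^+ k * s k /\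
  (map_poly intr (Defs.chebyshev k.+1)).[- (x + y)] = (-1) ^+ k.+1 * s k.+1.
  by case/(_ m).
elim=> [|k [IH1 IH2]].
  rewrite /Defs.chebyshev /= rmorph1 hornerC map_polyX hornerX /s !big_ord_recl !big_ord0.
  by split; rewrite /bump /= ?expr0 ?expr1; ring.
split=> //; rewrite chebyshevS rmorphB rmorphM /= map_polyX hornerD hornerN hornerM hornerX.
by rewrite IH1 IH2 s2 !exprS; ring.
Qed.

End Unknot.

Lemma chebyshev_size_coef m :
  (size (Defs.chebyshev m) <= m.+1)%N /\ forall i, `|(Defs.chebyshev m)`_i| <= 2 ^+ m.
Proof.
pose bounded k := (size (Defs.chebyshev k) <= k.+1)%N /\
  forall i, `|(Defs.chebyshev k)`_i| <= 2 ^+ k.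
suff : forall k, bounded k /\ bounded k.+1.
  by case/(_ m).
elim=> [|k [[sz1 c1] [sz2 c2]]].
  rewrite /bounded /Defs.chebyshev /= size_polyX size_poly1; split; split=> // i.
    by rewrite coef1; case: eqP.
  by rewrite coefX; case: eqP.
split=> //; rewrite /bounded chebyshevS; split=> [|i].
  apply: leq_trans (size_polyD _ _) _; rewrite geq_max size_polyN.
  apply/andP; split; last by apply: leq_trans sz1 _; rewrite ltnW.
  by apply: leq_trans (size_polyMleq _ _) _; rewrite size_polyX.
rewrite coefB coefXM; apply: le_trans (ler_normB _ _) _.
have h : `|if i == 0%N then 0 else (Defs.chebyshev k.+1)`_i.-1| <= 2 ^+ k.+1 :> int.
  by case: ifP => // _; rewrite normr0 exprn_ge0.
apply: le_trans (lerD h (c1 i)) _; rewrite !exprS.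
by have : 0 <= 2 ^+ k :> int by []; lia.
Qed.

(** * The colored Jones polynomial near q = 1 *)

Section JonesBound.
Variable R : realType.

(** An upper bound of [cable_cost] that does not depend on the number of parallel
    copies: [(1 + 2/n)^m <= e^2] when [m <= n]. *)
Definition slice_bound (x : slice) : R :=
  match x with Cup _ _ => 2 | Cap _ => 4 | Cross _ _ => expR 2 end.

Definition diagram_bound (D : seq slice) : R := \prod_(x <- D) slice_bound x.

Lemma slice_bound_ge1 x : 1 <= slice_bound x.
Proof. case: x => [i b|i|i b] /=; [lra|lra|]. by have := @expR_ge1Dx R 2; lra. Qed.

Lemma diagram_bound_ge1 D : 1 <= diagram_bound D.
Proof.
rewrite /diagram_bound; elim: D => [|x D IH]; first by rewrite big_nil.
by rewrite big_cons mulr_ege1 ?slice_bound_ge1.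
Qed.

Lemma cexp_close (z : R[i]) : modulus z <= 1 / 2 ->
  modulus (cexp z) <= 1 + 2 * modulus z.
Proof.
move=> /modulus_cexp_sub1 e; have -> : cexp z = 1 + (cexp z - 1) by ring.
by apply: le_trans (modulusD _ _) _; rewrite modulus1 lerD2l.
Qed.

(** The diagonal entry is [A ((A^-2 - 1) - (A^2 - 1))] with [A = e^w], which is
    of first order in [w]. *)
Lemma crossing_cost (w : R[i]) : modulus w <= 1 / 8 ->
  modulus (cexp w) + modulus ((cexp w)^-1 - cexp w ^+ 3) <= 1 + 16 * modulus w.
Proof.
move=> w8; have w0 := modulus_ge0 w.
have m2 : modulus (2%:R * w) = 2 * modulus w by rewrite modulusM modulus_nat.
have -> : (cexp w)^-1 - cexp w ^+ 3 =
    cexp w * ((cexp (- (2%:R * w)) - 1) - (cexp (2%:R * w) - 1)).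
  rewrite cexpN -cexpX; have := cexp_neq0 w; move: (cexp w) => x x0.
  by field.
have e1 : modulus (cexp (2%:R * w) - 1) <= 4 * modulus w.
  by apply: le_trans (modulus_cexp_sub1 _) _; rewrite m2; lra.
have e2 : modulus (cexp (- (2%:R * w)) - 1) <= 4 * modulus w.
  by apply: le_trans (modulus_cexp_sub1 _) _; rewrite modulusN m2; lra.
have e3 : modulus (cexp w) <= 1 + 2 * modulus w by apply: cexp_close; lra.
have e4 := le_trans (modulusB _ _) (lerD e2 e1).
have e5 : modulus (cexp w) * modulus (cexp (- (2%:R * w)) - 1 - (cexp (2%:R * w) - 1)) <=
   (5 / 4) * (8 * modulus w).
  by apply: ler_pM; rewrite ?modulus_ge0//; lra.
rewrite modulusM; lra.
Qed.

Variables (n : nat) (h : R[i]).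
Hypothesis n_gt0 : (0 < n)%N.
Hypothesis h_small : n%:R * modulus h <= 1 / 2.

Let A := cexp (- (h / 4%:R)).
Let kappa : R := 1 + 2 / n%:R.

Let hn : modulus h <= 1 / 2 / n%:R.
Proof. by rewrite ler_pdivlMr ?ltr0n// mulrC. Qed.

Let h2 : modulus h <= 1 / 2.
Proof.
apply: le_trans h_small; rewrite ler_peMl ?modulus_ge0//.
by rewrite ler1n.
Qed.

Let mh4 : modulus (h / 4%:R) = modulus h / 4.
Proof. by rewrite modulusM modulusV modulus_nat. Qed.

Let A_neq0 : A != 0. Proof. exact: cexp_neq0. Qed.

Let AV : A^-1 = cexp (h / 4%:R). Proof. by rewrite -cexpN opprK. Qed.

Lemma modulus_bracket_zero_framed (K : knot) m : (m <= n)%N ->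
  modulus (bracket A [::] (cable m (zero_framed K))) <=
  diagram_bound (zero_framed K) ^+ n.
Proof.
move=> mn; have h0 := modulus_ge0 h; have hh := h2; have hhn := hn.
have w8 : modulus (h / 4%:R) <= 1 / 8 by rewrite mh4; lra.
have w8' : modulus (- (h / 4%:R)) <= 1 / 8 by rewrite modulusN.
have kB : 16 * modulus (h / 4%:R) <= 2 / n%:R by rewrite mh4; lra.
have A2 : modulus A <= 2.
  by apply: le_trans (cexp_close _) _; rewrite modulusN mh4; lra.
have AV2 : modulus A^-1 <= 2.
  by rewrite AV; apply: le_trans (cexp_close _) _; rewrite mh4; lra.
have kA : modulus A + modulus (A^-1 - A ^+ 3) <= kappa.
  by apply: le_trans (crossing_cost w8') _; rewrite modulusN lerD2l.
have kAV : modulus A^-1 + modulus (A - A ^- 3) <= kappa.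
  have := crossing_cost w8; rewrite -AV invrK exprVn => e.
  by apply: le_trans e _; rewrite lerD2l.
have := modulus_bracket_cable A2 AV2 A_neq0 kA kAV m (well_formed_zero_framed K).
move=> /le_trans; apply; apply: (@le_trans _ _ (diagram_bound (zero_framed K) ^+ m)).
  apply: lerXn2r; rewrite ?nnegrE.
  - apply: prodr_ge0 => -[i b|i|i b] _ //=.
    by rewrite exprn_ge0// addr_ge0// divr_ge0.
  - by apply: le_trans (diagram_bound_ge1 _).
  apply: ler_prod => -[i b|i|i b] _ /=; rewrite ?lexx ?ler0n//.
  have k1 : 1 <= kappa by rewrite lerDl divr_ge0.
  rewrite exprn_ge0 ?(le_trans _ k1)//=.
  apply: le_trans (ler_weXn2l k1 mn) _.
  have -> : expR 2 = expR (2 / n%:R) ^+ n :> R.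
    by rewrite -expRM_natr divfK// pnatr_eq0 -lt0n.
  apply: lerXn2r; rewrite ?nnegrE ?expR_ge0 ?(le_trans _ k1)//.
  exact: expR_ge1Dx.
by apply: ler_weXn2l => //; exact: diagram_bound_ge1.
Qed.

Lemma modulus_cable_bracket_zero_framed (K : knot) :
  modulus (cable_bracket_at A (Defs.chebyshev n.-1) (zero_framed K)) <=
  (4 * diagram_bound (zero_framed K)) ^+ n.
Proof.
have [sz co] := chebyshev_size_coef n.-1; rewrite prednK// in sz.
set G := diagram_bound _; have G1 : 1 <= G := diagram_bound_ge1 _.
apply: le_trans (modulus_sum _ _ _) _.
apply: (@le_trans _ _ (\sum_(m < size (Defs.chebyshev n.-1)) 2 ^+ n * G ^+ n)).
  apply: ler_sum => m _; rewrite modulusM; apply: ler_pM; rewrite ?modulus_ge0//.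
    rewrite modulus_int -intr_norm; apply: (@le_trans _ _ ((2 ^+ n.-1 : int)%:~R)).
      by rewrite ler_int.
    rewrite rmorphXn /= ler_weXn2l ?leq_pred//.
    by rewrite (_ : 2%:~R = 2)// ler1n.
  by apply: modulus_bracket_zero_framed; rewrite ltnW// (leq_trans (ltn_ord m)).
rewrite sumr_const card_ord -[leLHS]mulr_natl.
have -> : (4 * G) ^+ n = 2 ^+ n * (2 ^+ n * G ^+ n).
  by rewrite -!exprMn; congr (_ ^+ _); ring.
apply: ler_wpM2r; first by rewrite mulr_ge0 ?exprn_ge0// (le_trans _ G1).
rewrite -natrX ler_nat; apply: leq_trans sz _.
by rewrite ltnW// ltn_expl.
Qed.

(** Every summand of the quantum integer is [e^u] with [|u| <= 1/4], hence has real
    part at least [1/2]. *)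
Lemma modulus_cable_bracket_unknot :
  1 / 2 <= modulus (cable_bracket_at A (Defs.chebyshev n.-1) unknot_diagram).
Proof.
rewrite cable_bracket_unknot.
have -> : loop_value A = - (A ^+ 2 + A^-1 ^+ 2) by rewrite /loop_value exprVn; ring.
rewrite horner_chebyshev; last by rewrite -exprMn mulfV ?expr1n.
rewrite modulusM modulusX modulusN modulus1 expr1n [leRHS]mul1r prednK//.
apply: le_trans (Re_le_modulus _).
have term (j : 'I_n) : 1 / 2 <= complex.Re ((A ^+ 2) ^+ (n.-1 - j) * (A^-1 ^+ 2) ^+ j).
  set t := (X in complex.Re X); have Dt : exists2 u, t = cexp u & modulus u <= 1 / 4.
    exists (((2 * (n.-1 - j))%N%:R) * - (h / 4%:R) + (2 * j)%N%:R * (h / 4%:R)).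
      by rewrite /t cexpD -!cexpX -AV -!exprM.
    apply: le_trans (modulusD _ _) _; rewrite !(modulusN, modulusM, modulusV, modulus_nat).
    rewrite -mulrDl -natrD -mulnDr subnK; last by rewrite -ltnS prednK.
    rewrite natrM; have : n.-1%:R <= n%:R :> R by rewrite ler_nat leq_pred.
    have := modulus_ge0 h; have := h_small; move: (modulus h) (n.-1%:R) => y x; nra.
  have [u -> u4] := Dt; have e : modulus (1 - cexp u) <= 1 / 2.
    rewrite -modulusN opprB; apply: le_trans (modulus_cexp_sub1 _) _; lra.
  have := le_trans (Re_le_modulus _) e; rewrite raddfB /=; lra.
rewrite raddf_sum /=; apply: (@le_trans _ _ (\sum_(j < n) (1 / 2 : R))); last first.
  by apply: ler_sum => j _; exact: term.
rewrite sumr_const card_ord -[leRHS]mulr_natr.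
by have : 1 <= n%:R :> R; [rewrite ler1n|lra].
Qed.

(** Cables have [O(n^2)] crossings, each of norm [1 + O(1/n)], whence a bound that
    is exponential in [n] and not in [n^2]. *)
Lemma colored_jones_bound (K : knot) (J : laurent int) :
  is_colored_jones K n J ->
  modulus (levalZ J (cexp h)) <= (8 * diagram_bound (zero_framed K)) ^+ n.
Proof.
move=> Jn; have U2 := modulus_cable_bracket_unknot.
have U0 : cable_bracket_at A (Defs.chebyshev n.-1) unknot_diagram != 0.
  by rewrite -modulus_gt0; apply: lt_le_trans U2; lra.
have := colored_jones_at Jn A_neq0 U0.
have -> : A ^- 4 = cexp h.
  by rewrite -exprVn AV cexpX; congr cexp; rewrite mulrC divfK// pnatr_eq0.
move=> /(congr1 (@modulus R)); rewrite modulusM => E.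
have KB := modulus_cable_bracket_zero_framed K; rewrite -E in KB.
set x := modulus (levalZ _ _) in KB *.
set y := modulus (cable_bracket_at _ _ _) in KB U2.
have x0 : 0 <= x := modulus_ge0 _.
rewrite (_ : 8 = 2 * 4); last by ring.
rewrite -mulrA exprMn.
apply: (@le_trans _ _ (2 * (4 * diagram_bound (zero_framed K)) ^+ n)).
  by apply: le_trans (ler_wpM2l _ KB); [nra|].
apply: ler_wpM2r; first by apply: le_trans KB; rewrite mulr_ge0 ?modulus_ge0.
by rewrite -[leLHS]expr1 ler_weXn2l// ler1n.
Qed.

End JonesBound.

(** * Formal series and the size of the loop coefficients *)

Section FormalSeries.
Implicit Types f g h : fps.

(** Reduces identities between formal series to identities between polynomials. *)
Lemma fps_mul_coef f g n m : (n < m)%N ->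
  fps_mul f g n = ((\poly_(i < m) f i) * (\poly_(i < m) g i))`_n.
Proof.
move=> nm; rewrite coefM; apply: eq_bigr => i _; rewrite !coef_poly.
by rewrite (leq_trans (ltn_ord i))// (leq_ltn_trans (leq_subr _ _)).
Qed.

Lemma coefM_trunc (p p' q q' : {poly rat}) n :
  (forall i, (i <= n)%N -> p`_i = p'`_i) -> (forall i, (i <= n)%N -> q`_i = q'`_i) ->
  (p * q)`_n = (p' * q')`_n.
Proof.
move=> pp qq; rewrite !coefM; apply: eq_bigr => i _.
by rewrite pp -1?ltnS// qq// leq_subr.
Qed.

Lemma fps_mulC f g : fps_mul f g =1 fps_mul g f.
Proof. by move=> n; rewrite !(fps_mul_coef _ _ (ltnSn n)) mulrC. Qed.

Lemma fps_mulA f g h : fps_mul f (fps_mul g h) =1 fps_mul (fps_mul f g) h.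
Proof.
move=> n; rewrite !(fps_mul_coef _ _ (ltnSn n)).
set F := \poly_(i < n.+1) f i; set G := \poly_(i < n.+1) g i.
set H := \poly_(i < n.+1) h i.
transitivity ((F * (G * H))`_n); [|rewrite mulrA]; apply: coefM_trunc => // i i_n;
  by rewrite coef_poly ltnS i_n -(fps_mul_coef _ _ (m := n.+1)) ?ltnS.
Qed.

Lemma eq_fps_mul f f' g g' : f =1 f' -> g =1 g' -> fps_mul f g =1 fps_mul f' g'.
Proof. by move=> ff gg n; apply: eq_bigr => i _; rewrite ff gg. Qed.

Lemma fps_mul_powS f g p :
  fps_mul f (fps_pow g p.+1) =1 fps_mul g (fps_mul f (fps_pow g p)).
Proof.
move=> n; rewrite /fps_pow iterS fps_mulA [RHS]fps_mulA.
by apply: eq_fps_mul => // m; exact: fps_mulC.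
Qed.

Lemma fps_mul_pow0 f g : fps_mul f (fps_pow g 0) =1 f.
Proof.
move=> n; rewrite /fps_mul big_ord_recr /= subnn mulr1 big1 ?add0r// => i _.
by rewrite subn_eq0 leqNgt ltn_ord mulr0.
Qed.

Variable R : realType.
Variables (D : fps) (M : R).
Hypothesis M_gt0 : 0 < M.
Hypothesis D0 : D 0%N = 1.
Hypothesis D_bound : forall i, `|ratr (D i.+1) : R| <= (M / 4) ^+ i.+1.

(** In the recursion [f_j = (D f)_j - \sum_i D_(i+1) f_(j-i-1)] the sum is, by
    induction, at most half of the claimed bound. *)
Lemma fps_div_bound f C :
  (forall j, `|ratr (fps_mul D f j) : R| <= C * M ^+ j) ->
  forall j, `|ratr (f j) : R| <= 2 * C * M ^+ j.
Proof.
move=> Df j; have C0 : 0 <= C.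
  by apply: le_trans (normr_ge0 _) (le_trans (Df 0%N) _); rewrite mulr1.
elim/ltn_ind: j => j IH.
have -> : f j = fps_mul D f j - \sum_(i < j) D i.+1 * f (j - i.+1)%N.
  by rewrite /fps_mul big_ord_recl /= D0 mul1r subn0 /bump /=; ring.
rewrite rmorphB /= [X in _ - X]rmorph_sum; apply: le_trans (ler_normB _ _) _.
rewrite (_ : 2 * C * M ^+ j = C * M ^+ j + C * M ^+ j); last by ring.
apply: lerD; first exact: Df.
apply: le_trans (ler_norm_sum _ _ _) _.
(* The factor 4 leaves |D_i| M^-i <= 4^-i, whose sum is at most 1/2. *)
apply: (@le_trans _ _ (\sum_(i < j) (C * M ^+ j / 2) * (1 / 4) ^+ i)).
  apply: ler_sum => i _; rewrite rmorphM normrM.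
  have ij : j = (i.+1 + (j - i.+1))%N by rewrite subnKC.
  have -> : C * M ^+ j / 2 * (1 / 4) ^+ i =
      (M / 4) ^+ i.+1 * (2 * C * M ^+ (j - i.+1)).
    by rewrite {1}ij exprD !exprMn expr1n !exprS; field.
  by apply: ler_pM; rewrite ?D_bound//; apply: IH; lia.
rewrite -mulr_sumr; have : \sum_(i < j) (1 / 4 : R) ^+ i <= 2.
  by apply: geometric_sum_le; lra.
have : 0 <= C * M ^+ j by rewrite mulr_ge0// exprn_ge0// ltW.
by nra.
Qed.

(** Dividing by one factor at a time keeps the rate [M] whatever the exponent. *)
Lemma fps_div_pow_bound f p C :
  (forall j, `|ratr (fps_mul f (fps_pow D p) j) : R| <= C * M ^+ j) ->
  forall j, `|ratr (f j) : R| <= 2 ^+ p * C * M ^+ j.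
Proof.
elim: p C => [|p IH] C fC j.
  by have := fC j; rewrite fps_mul_pow0 expr0 mul1r.
rewrite exprSr -[2 ^+ p * 2 * C]mulrA; apply: IH.
by apply: fps_div_bound => i; rewrite -fps_mul_powS; exact: fC.
Qed.

End FormalSeries.

Section LaurentExp.
Variable R : realType.

Lemma leval_sum (A : nzRingType) (g : A -> R[i]) L z : g 0 = 0 ->
  leval g L (cexp z) =
  \sum_(i < size (lpoly L)) g (lpoly L)`_i * cexp ((i%:R - (Defs.lshift L)%:R) * z).
Proof.
move=> g0; rewrite /leval (horner_coef_wide _ (size_poly _ _)) mulr_suml.
apply: eq_bigr => i _; rewrite coef_map_id0// mulrBl cexpD cexpN -!cexpX.
by rewrite mulrA.
Qed.

Lemma leval_rate (A : nzRingType) (f : A -> rat) (g : A -> R[i]) L z theta :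
  g 0 = 0 -> (forall c, g c = ratr (f c)) -> 0 < theta <= 1 / 2 ->
  converges_at_rate theta (fun j => ratr (laurent_exp f L j) * z ^+ j)
    (leval g L (cexp z)).
Proof.
move=> g0 gf th; rewrite leval_sum//.
pose e (i : nat) : R[i] := i%:R - (Defs.lshift L)%:R.
have h i := rateZ (g (lpoly L)`_i) (cexp_rate (e i * z) th).
have [C hC] := rate_sum (size (lpoly L)) h; exists C => n; apply: le_trans (hC n).
rewrite le_eqVlt; apply/orP; left; apply/eqP; congr (modulus (_ - _)).
apply: eq_bigr => j _; rewrite /laurent_exp rmorph_sum mulr_suml.
apply: eq_bigr => i _; rewrite gf !rmorphM fmorphV rmorphXn rmorphB !rmorph_nat /=.
by rewrite -/(e i) exprMn; ring.
Qed.

Lemma modulus_ratr (x : rat) : modulus (ratr x : R[i]) = `|ratr x : R|.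
Proof.
rewrite -modulus_real; congr modulus.
by rewrite /ratr fmorph_div !rmorph_int.
Qed.

Lemma levalZ_rate L z theta : 0 < theta <= 1 / 2 ->
  converges_at_rate theta (fun j => ratr (laurent_expZ L j) * z ^+ j)
    (levalZ L (cexp z) : R[i]).
Proof. by apply: leval_rate => // c; rewrite ratr_int. Qed.

Lemma levalQ_rate L z theta : 0 < theta <= 1 / 2 ->
  converges_at_rate theta (fun j => ratr (laurent_expQ L j) * z ^+ j)
    (levalQ L (cexp z) : R[i]).
Proof. by apply: leval_rate => //; exact: rmorph0. Qed.

Lemma rate_coef (M : R) (a : nat -> rat) (w : R[i]) : 0 < M ->
  converges_at_rate (1 / 2) (fun j => ratr (a j) * (2 * M)^-1%:C%C ^+ j) w ->
  exists C, forall j, `|ratr (a j) : R| <= C * M ^+ j.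
Proof.
move=> M0 aw; have [|C aC] := rate_terms _ aw; first by lra.
exists C => j; have := aC j; rewrite modulusM modulus_ratr modulusX modulus_real.
rewrite (@ger0_norm _ (2 * M)^-1); last by rewrite invr_ge0; lra.
rewrite div1r invfM exprMn => h.
rewrite -(ler_pM2r (_ : 0 < 2^-1 ^+ j * M^-1 ^+ j)); last first.
  by rewrite mulr_gt0// exprn_gt0// invr_gt0.
apply: le_trans h _; rewrite le_eqVlt; apply/orP; left; apply/eqP.
have MM : M ^+ j * M^-1 ^+ j = 1 by rewrite -exprMn mulfV ?gt_eqF// expr1n.
have -> : C * M ^+ j * (2^-1 ^+ j * M^-1 ^+ j) = C * 2^-1 ^+ j * (M ^+ j * M^-1 ^+ j).
  by ring.
by rewrite MM mulr1.
Qed.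

Lemma levalZ_coef_bound L M : 0 < M ->
  exists C, forall j, `|ratr (laurent_expZ L j) : R| <= C * M ^+ j.
Proof. by move=> M0; apply: (rate_coef M0); apply: levalZ_rate; lra. Qed.

Lemma levalQ_coef_bound L M : 0 < M ->
  exists C, forall j, `|ratr (laurent_expQ L j) : R| <= C * M ^+ j.
Proof. by move=> M0; apply: (rate_coef M0); apply: levalQ_rate; lra. Qed.

Lemma laurent_expZ0 (L : laurent int) : levalZ L (1 : rat) = 1 -> laurent_expZ L 0 = 1.
Proof.
rewrite /levalZ /leval expr1n divr1 => <-; rewrite /laurent_expZ /laurent_exp.
rewrite (horner_coef_wide _ (size_poly _ _)); apply: eq_bigr => i _.
by rewrite coef_map_id0// expr0 divr1 expr1n.
Qed.

(** A large [M] absorbs the constant [C] into the rate, as no bound is required on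
    the constant term. *)
Lemma sharp_coef_bound (a : fps) : (forall M : R, 0 < M ->
    exists C, forall j, `|ratr (a j) : R| <= C * M ^+ j) ->
  exists2 M : R, 1 <= M & forall i, `|ratr (a i.+1) : R| <= (M / 4) ^+ i.+1.
Proof.
move=> /(_ 1 ltr01)[C aC]; exists (4 * (1 + `|C|)); first by have := normr_ge0 C; lra.
move=> i; apply: le_trans (aC i.+1) _; rewrite expr1n mulr1.
have C0 := normr_ge0 C; apply: (@le_trans _ _ (1 + `|C|)).
  by apply: le_trans (ler_norm _) _; lra.
rewrite [4 * _]mulrC mulfK; last by rewrite pnatr_eq0.
by rewrite -[leLHS]expr1 ler_weXn2l//; lra.
Qed.

End LaurentExp.

Section LoopCoefficients.
Variable R : realType.

(** The rate [M] depends on [Delta] only, whereas [C] may depend on [k]. *)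
Lemma loop_coef_bound (Delta : laurent int) (P : nat -> laurent rat)
    (S : nat -> fps) :
  levalZ Delta (1 : rat) = 1 ->
  (forall k, fps_mul (S k) (fps_pow (laurent_expZ Delta) (2 * k).+1%N)
               =1 laurent_expQ (P k)) ->
  exists M : R, [/\ 1 <= M,
    forall i, `|ratr (laurent_expZ Delta i.+1) : R| <= (M / 4) ^+ i.+1 &
    forall k, exists C, forall j, `|ratr (S k j) : R| <= C * M ^+ j].
Proof.
move=> D1 SP; have [M M1 DM] := sharp_coef_bound (@levalZ_coef_bound R Delta).
exists M; split=> // k; have M0 : 0 < M by lra.
have [C PC] := levalQ_coef_bound (P k) M0.
exists (2 ^+ (2 * k).+1 * C).
apply: (fps_div_pow_bound M0 (laurent_expZ0 D1) DM) => j.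
by rewrite SP.
Qed.

End LoopCoefficients.

(** * Interpolation in the color *)

Section Interpolation.
Variable R : realType.

Lemma size_forward_difference (q : {poly R}) d : (size q <= d.+1)%N ->
  (size (q \Po ('X + 1%:P) - q)%R <= d)%N.
Proof.
elim/poly_ind: q d => [|p c IH] d; first by rewrite comp_poly0 subr0 size_poly0.
rewrite size_MXaddC; case: ifP => [/andP[/eqP-> /eqP->] _|_].
  by rewrite mul0r add0r comp_polyC subrr size_poly0.
rewrite ltnS => pd; rewrite comp_polyD comp_polyM comp_polyX comp_polyC.
case: d pd => [|d] pd.
  move: pd; rewrite leqn0 size_poly_eq0 => /eqP->.
  by rewrite comp_poly0 !mul0r add0r subrr size_poly0.
have -> : (p \Po ('X + 1%:P)) * ('X + 1%:P) + c%:P - (p * 'X + c%:P) =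
   ((p \Po ('X + 1%:P)) - p) * 'X + (p \Po ('X + 1%:P)) by rewrite polyC1; ring.
apply: leq_trans (size_polyD _ _) _; rewrite geq_max; apply/andP; split.
  by apply: leq_trans (size_polyMleq _ _) _; rewrite size_polyX addn2 ltnS IH.
by rewrite size_comp_poly2// size_XaddC.
Qed.

(** Newton's forward differences: a difference lowers the degree and doubles the
    bound, and summation turns one binomial coefficient into the next. *)
Lemma interpolation_bound d (q : {poly R}) B : (size q <= d.+1)%N ->
  (forall j, (j <= d)%N -> `|q.[j.+1%:R]| <= B) ->
  forall n, `|q.[n.+1%:R]| <= B * 2 ^+ d * 'C(n + d, d)%:R.
Proof.
elim: d q B => [|d IH] q B sz qB n.
  rewrite expr0 bin0 !mulr1.
  by have := qB 0%N isT; rewrite (size1_polyC sz) !hornerC.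
have B0 : 0 <= B := le_trans (normr_ge0 _) (qB 0%N isT).
pose p := (q \Po ('X + 1%:P)) - q.
have pE m : p.[m%:R] = q.[m.+1%:R] - q.[m%:R].
  by rewrite /p hornerD hornerN horner_comp hornerD hornerX hornerC natr1.
have pB m : `|p.[m.+1%:R]| <= 2 * B * 2 ^+ d * 'C(m + d, d)%:R.
  apply: IH => [|j jd]; first exact: size_forward_difference.
  rewrite pE; apply: le_trans (ler_normB _ _) _.
  rewrite (_ : 2 * B = B + B); last by ring.
  by apply: lerD; apply: qB; lia.
elim: n => [|n IHn].
  rewrite add0n binn mulr1; apply: le_trans (qB 0%N isT) _.
  by rewrite ler_peMr// exprn_ege1// ler1n.
have -> : q.[n.+2%:R] = q.[n.+1%:R] + p.[n.+1%:R] by rewrite pE; ring.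
apply: le_trans (ler_normD _ _) _; apply: le_trans (lerD IHn (pB n)) _.
rewrite addSn binS natrD mulrDr addnS lerD2l exprS.
rewrite (_ : 2 * B * 2 ^+ d = B * (2 * 2 ^+ d)); last by ring.
apply: ler_wpM2l; first by rewrite !mulr_ge0// exprn_ge0.
by rewrite ler_nat leq_bin2l.
Qed.

Lemma ffact_le_exp n m : (n ^_ m <= n ^ m)%N.
Proof.
elim: m n => [|m IH] [|n]; rewrite ?ffactn0 ?expn0 ?ffact0n//.
rewrite ffactSS expnS leq_mul//; apply: leq_trans (IH n) _.
by case: (m) => // k; rewrite leq_exp2r.
Qed.

Lemma pow_le_fact_exp (x : R) m : 0 <= x -> x ^+ m / m`!%:R <= expR x.
Proof.
case: m => [|m] x0; last by have := expR_ge1Dxn m x0; lra.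
by rewrite expr0 divr1; have := @expR_ge1Dx R x; lra.
Qed.

(** The interpolation constant [(d+1)^d / d!] is exponential in [d], so a bound
    [C L^d n^d] at the [d+1] nodes persists with a multiple of [L]. *)
Lemma interpolation_growth d (q : {poly R}) C L : 0 <= C -> 0 <= L ->
  (size q <= d.+1)%N ->
  (forall n, (0 < n <= d.+1)%N -> `|q.[n%:R]| <= C * L ^+ d * n%:R ^+ d) ->
  forall n, (d < n)%N ->
    `|q.[n%:R]| <= C * expR 1 * (4 * expR 1 * L) ^+ d * n%:R ^+ d.
Proof.
move=> C0 L0 sz qC [//|n] dn.
pose e : R := expR 1; have e0 : 0 <= e := expR_ge0 _.
have qB j : (j <= d)%N -> `|q.[j.+1%:R]| <= C * L ^+ d * d.+1%:R ^+ d.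
  move=> jd; apply: le_trans (qC _ _) _; first by rewrite ltnS.
  by apply: ler_wpM2l; rewrite ?mulr_ge0 ?exprn_ge0// lerXn2r ?nnegrE// ler_nat ltnS.
apply: le_trans (interpolation_bound sz qB n) _.
have f0 : 0 < d`!%:R :> R by rewrite ltr0n fact_gt0.
have b1 : 'C(n + d, d)%:R <= (2 * n.+1%:R) ^+ d / d`!%:R :> R.
  rewrite ler_pdivlMr// -[X in X <= _]natrM bin_ffact -natrM -natrX ler_nat.
  apply: leq_trans (ffact_le_exp _ _) _.
  by case: (d) dn => // k kn; rewrite leq_exp2r; lia.
have b2 : d.+1%:R ^+ d / d`!%:R <= e * e ^+ d.
  apply: le_trans (pow_le_fact_exp _ _) _ => //.
  by rewrite -exprS -(mulr1 d.+1%:R) expRM_natl.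
apply: (@le_trans _ _ (C * L ^+ d * d.+1%:R ^+ d * 2 ^+ d * ((2 * n.+1%:R) ^+ d / d`!%:R))).
  by apply: ler_wpM2l; rewrite ?mulr_ge0 ?exprn_ge0.
have -> : C * L ^+ d * d.+1%:R ^+ d * 2 ^+ d * ((2 * n.+1%:R) ^+ d / d`!%:R) =
   C * (4 * L) ^+ d * n.+1%:R ^+ d * (d.+1%:R ^+ d / d`!%:R).
  rewrite (_ : 4 = 2 * 2); last by ring.
  by rewrite !exprMn; ring.
have -> : C * e * (4 * e * L) ^+ d * n.+1%:R ^+ d =
   C * (4 * L) ^+ d * n.+1%:R ^+ d * (e * e ^+ d).
  by rewrite !exprMn; ring.
by apply: ler_wpM2l => //; rewrite !mulr_ge0// exprn_ge0// mulr_ge0.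
Qed.

End Interpolation.

Section RemainderCoefficients.
Variables (R : realType) (S : nat -> fps).

(** By the loop expansion, the coefficient of [z^d] in
    [loop_error J Delta P N n z]. *)
Definition remainder_coef (N n : nat) : fps :=
  fun d => \sum_(i < d.+1) S (N + i) (d - i)%N / n%:R ^+ i.

Lemma remainder_coef0 N n : remainder_coef N n 0 = S N 0.
Proof. by rewrite /remainder_coef big_ord1 addn0 expr0 divr1. Qed.

Lemma remainder_coefS N n d :
  remainder_coef N n d.+1 = S N d.+1 + remainder_coef N.+1 n d / n%:R.
Proof.
rewrite /remainder_coef big_ord_recl /= addn0 expr0 divr1 subn0; congr (_ + _).
rewrite mulr_suml; apply: eq_bigr => i _.
by rewrite /bump /= add1n addnS addSn subSS exprS invfM; ring.
Qed.

(** Polynomiality in the color [n], which makes interpolation possible. *)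
Lemma remainder_coef_horner N n d : (0 < n)%N ->
  (ratr (remainder_coef N n d) : R) * n%:R ^+ d =
  (\poly_(l < d.+1) (ratr (S (N + (d - l)) l) : R)).[n%:R].
Proof.
move=> n0; rewrite horner_poly /remainder_coef rmorph_sum mulr_suml.
rewrite (reindex_inj rev_ord_inj) /=; apply: eq_bigr => i _.
have id_ : (i <= d)%N by rewrite -ltnS.
rewrite subSS subKn// rmorphM fmorphV rmorphXn rmorph_nat -mulrA; congr (_ * _).
have nn : n%:R != 0 :> R by rewrite pnatr_eq0 -lt0n.
move: (nat_of_ord i) id_ => k kd.
by rewrite -{2}(subnK kd) exprD mulKf// expf_neq0.
Qed.

Variables (M G : R).
Hypothesis M_ge1 : 1 <= M.
Hypothesis G_ge1 : 1 <= G.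
Hypothesis S_bound : forall k, exists C, forall j, `|ratr (S k j) : R| <= C * M ^+ j.
Hypothesis initial_bound : forall n d, (0 < n)%N ->
  `|ratr (remainder_coef 0 n d) : R| <= G ^+ n * 2 ^+ d.

(** Passing from [N] to [N+1] multiplies by [n], which is at most [d+1] at the
    nodes.  The loss is a power of [d+1] and leaves the exponential rate alone. *)
Lemma remainder_coef_node_bound N : exists2 C, 0 <= C &
  forall n d, (0 < n <= d.+1)%N ->
  `|ratr (remainder_coef N n d) : R| <= C * d.+1%:R ^+ N * (2 * G * M) ^+ d.
Proof.
have M1 := M_ge1; have G1 := G_ge1.
have GM : M <= G * M by rewrite ler_peMl//; lra.
have GM' : G <= G * M by rewrite ler_peMr//; lra.
have ML : M <= 2 * G * M by rewrite -mulrA; lra.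
have L1 : 1 <= 2 * G * M by lra.
elim: N => [|N [C C0 IH]].
  exists G; first by lra.
  move=> n d /andP[n0 nd]; apply: le_trans (initial_bound d n0) _.
  apply: (@le_trans _ _ (G ^+ d.+1 * 2 ^+ d)).
    by apply: ler_wpM2r; rewrite ?exprn_ge0// ler_weXn2l.
  rewrite expr0 mulr1 exprS -mulrA -exprMn mulrC [leRHS]mulrC.
  by apply: ler_wpM2r; [lra|apply: lerXn2r; rewrite ?nnegrE ?[2 * G]mulrC -?mulrA; lra].
have [C' SC] := S_bound N; have C'0 : 0 <= C'.
  by apply: le_trans (normr_ge0 _) (le_trans (SC 0%N) _); rewrite mulr1.
exists ((C * 2 ^+ N + C') * (2 * G * M)).
  by rewrite mulr_ge0 ?addr_ge0 ?mulr_ge0 ?exprn_ge0//; lra.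
move=> n d /andP[n0 nd].
have nn : n%:R != 0 :> R by rewrite pnatr_eq0 -lt0n.
have -> : (ratr (remainder_coef N.+1 n d) : R) =
  n%:R * (ratr (remainder_coef N n d.+1) - ratr (S N d.+1)).
  by rewrite remainder_coefS rmorphD rmorphM fmorphV rmorph_nat; field.
rewrite normrM normr_nat.
have hd : n%:R <= d.+1%:R :> R by rewrite ler_nat.
have h1 : `|ratr (remainder_coef N n d.+1) : R| <=
    C * 2 ^+ N * d.+1%:R ^+ N * (2 * G * M) ^+ d.+1.
  apply: le_trans (IH _ _ _) _; first by rewrite n0 leqW.
  apply: ler_wpM2r; first by rewrite exprn_ge0//; lra.
  rewrite -mulrA -exprMn; apply: ler_wpM2l => //; apply: lerXn2r; rewrite ?nnegrE ?mulr_ge0//.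
  by rewrite -natrM ler_nat; lia.
have h2 : `|ratr (S N d.+1) : R| <= C' * d.+1%:R ^+ N * (2 * G * M) ^+ d.+1.
  apply: le_trans (SC _) _; rewrite -mulrA; apply: ler_wpM2l => //.
  rewrite -[leLHS]mul1r; apply: ler_pM => //.
  - by rewrite exprn_ge0//; lra.
  - by rewrite exprn_ege1// ler1n.
  - by apply: lerXn2r; rewrite ?nnegrE; lra.
have h3 := le_trans (ler_normB _ _) (lerD h1 h2).
apply: le_trans (ler_pM _ _ hd h3) _ => //.
by rewrite le_eqVlt; apply/orP; left; apply/eqP; rewrite !exprS; ring.
Qed.

(** The rate [L] serves all [N] at once: the powers of [d+1] lost at the nodes are
    absorbed by [e^(d+1)], once and for all, and interpolation from the nodes
    is performed once for each [N], not successively. *)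
Lemma remainder_coef_bound : exists2 L, 2 * M <= L &
  forall N, exists2 C, 0 <= C & forall n d, (0 < n)%N ->
    `|ratr (remainder_coef N n d) : R| <= C * L ^+ d.
Proof.
have M1 := M_ge1; have G1 := G_ge1.
pose e : R := expR 1; have e1 : 2 <= e by have := @expR_ge1Dx R 1; rewrite -/e; lra.
(* [e] absorbs the powers of d+1, and 4 e is the cost of interpolation. *)
pose L0 := e * (2 * G * M).
have GM : M <= G * M by rewrite ler_peMl//; lra.
have L00 : 4 * M <= L0.
  by apply: (@le_trans _ _ (2 * (2 * G * M))); [lra|apply: ler_wpM2r; lra].
have eL0 : L0 <= e * L0 by rewrite ler_peMl//; lra.
exists (4 * e * L0); first by lra.
move=> N; have [C C0 hC] := remainder_coef_node_bound N.
pose C1 := C * N`!%:R * e; have C10 : 0 <= C1 by rewrite !mulr_ge0//; lra.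
have node n d : (0 < n <= d.+1)%N -> `|ratr (remainder_coef N n d) : R| <= C1 * L0 ^+ d.
  move=> nd; apply: le_trans (hC n d nd) _.
  rewrite (_ : C1 * L0 ^+ d = C * (N`!%:R * (e * e ^+ d)) * (2 * G * M) ^+ d); last first.
    by rewrite /C1 /L0 exprMn; ring.
  apply: ler_wpM2r; first by rewrite exprn_ge0//; nra.
  apply: ler_wpM2l => //; rewrite mulrC -ler_pdivrMr ?ltr0n ?fact_gt0//.
  apply: le_trans (pow_le_fact_exp _ _) _ => //.
  by rewrite -exprS -(mulr1 d.+1%:R) expRM_natl.
exists (C1 * e); first by nra.
move=> n d n0; have [nd|dn] := leqP n d.+1.
  apply: le_trans (node n d _) _; first by rewrite n0.
  apply: ler_pM => //; first by rewrite exprn_ge0//; lra.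
    by rewrite ler_peMr//; lra.
  by apply: lerXn2r; rewrite ?nnegrE; nra.
have np : 0 < n%:R ^+ d :> R by rewrite exprn_gt0// ltr0n.
rewrite -(ler_pM2r np) -[X in _ * X <= _](ger0_norm (ltW np)).
rewrite -normrM remainder_coef_horner//.
apply: (@interpolation_growth _ d _ C1 L0) => //; [lra| |exact: ltnW].
move=> m md; rewrite -remainder_coef_horner; last by case/andP: md.
rewrite normrM (@ger0_norm _ (m%:R ^+ d)) ?exprn_ge0//.
by apply: ler_wpM2r; rewrite ?exprn_ge0// node.
Qed.

End RemainderCoefficients.

(** * The remainders of the loop expansion *)

Section RateQuotient.
Variable R : realType.

Lemma rate_shift theta (u : nat -> R[i]) w : converges_at_rate theta u w ->
  converges_at_rate theta (fun d => u d.+1) (w - u 0%N).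
Proof.
move=> [C uw]; exists (C * theta) => n; rewrite -mulrA -exprS.
apply: le_trans (uw n.+1); rewrite big_ord_recl /= le_eqVlt; apply/orP; left.
by apply/eqP; congr modulus; rewrite opprD addrA.
Qed.

Lemma rate_eq theta (u v : nat -> R[i]) w w' :
  u =1 v -> w = w' -> converges_at_rate theta u w -> converges_at_rate theta v w'.
Proof.
move=> uv -> [C h]; exists C => n; apply: le_trans (h n).
rewrite le_eqVlt; apply/orP; left; apply/eqP; congr (modulus (_ - _)).
by apply: eq_bigr => j _; rewrite uv.
Qed.

(** The tails of [v] decay faster than the terms of [u], so that the cross terms
    add up to [O(theta^n)]. *)
Lemma rate_div theta (u v : nat -> R[i]) C p w : 0 < theta -> w != 0 ->
  (forall j, modulus (u j) <= C * theta ^+ j) ->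
  converges_at_rate (theta / 2) v w -> converges_at_rate theta (cauchy_product u v) p ->
  converges_at_rate theta u (p / w).
Proof.
move=> t0 w0 uC [C1 vw] [C2 uvp].
have C0 : 0 <= C by have := le_trans (modulus_ge0 _) (uC 0%N); rewrite mulr1.
have C10 : 0 <= C1 by have := le_trans (modulus_ge0 _) (vw 0%N); rewrite mulr1.
have mw : 0 < modulus w by rewrite modulus_gt0.
exists ((C2 + 2 * C * C1) / modulus w) => n.
rewrite mulrAC ler_pdivlMr// -modulusM mulrBl divfK//.
have -> : p - (\sum_(j < n) u j) * w =
  (p - \sum_(k < n) cauchy_product u v k) -
  \sum_(i < n) u i * (w - \sum_(j < n - i) v j).
  rewrite sum_cauchy_product; under [X in _ = _ - X]eq_bigr do rewrite mulrBr.
  by rewrite sumrB -mulr_suml; ring.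
apply: le_trans (modulusB _ _) _; rewrite [leRHS]mulrDl; apply: lerD => //.
apply: le_trans (modulus_sum _ _ _) _.
apply: (@le_trans _ _ (\sum_(i < n) C * C1 * theta ^+ n * (1 / 2) ^+ (n - i))).
  apply: ler_sum => i _; rewrite modulusM.
  have -> : C * C1 * theta ^+ n * (1 / 2) ^+ (n - i) =
    (C * theta ^+ i) * (C1 * (theta / 2) ^+ (n - i)).
    rewrite -{1}(subnK (ltnW (ltn_ord i))) exprD !exprMn expr1n; ring.
  by apply: ler_pM; rewrite ?modulus_ge0.
rewrite -mulr_sumr (_ : 2 * C * C1 * theta ^+ n = C * C1 * theta ^+ n * 2); last by ring.
apply: ler_wpM2l; first by rewrite !mulr_ge0// exprn_ge0// ltW.
rewrite (reindex_inj rev_ord_inj) /=.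
apply: (@le_trans _ _ (\sum_(j < n) (1 / 2 : R) ^+ j)); last first.
  by apply: geometric_sum_le; lra.
apply: ler_sum => j _; apply: ler_wiXn2l; [lra|lra|].
by rewrite subKn.
Qed.

Lemma cauchy_product_fps (f g : fps) (z : R[i]) n :
  cauchy_product (fun j => ratr (f j) * z ^+ j) (fun j => ratr (g j) * z ^+ j) n =
  ratr (fps_mul f g n) * z ^+ n.
Proof.
rewrite /cauchy_product /fps_mul rmorph_sum mulr_suml; apply: eq_bigr => i _.
have i_n : (i <= n)%N by rewrite -ltnS.
have -> : z ^+ n = z ^+ i * z ^+ (n - i) by rewrite -exprD subnKC.
by rewrite rmorphM /=; ring.
Qed.

Lemma fps_pow_rate (f : fps) (z w : R[i]) p theta :
  (forall t, 0 < t <= 1 / 2 -> converges_at_rate t (fun j => ratr (f j) * z ^+ j) w) ->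
  0 < theta <= 1 / 2 ->
  converges_at_rate theta (fun j => ratr (fps_pow f p j) * z ^+ j) (w ^+ p).
Proof.
move=> fw th; elim: p => [|p IH].
  exists 1 => n; case: n => [|n].
    by rewrite big_ord0 subr0 modulus1 mulr1.
  rewrite big_ord_recl /= rmorph1 mul1r !expr0 big1 => [|i _].
    by rewrite addr0 !mul1r subrr modulus0 exprn_ge0//; case/andP: th => /ltW.
  by rewrite rmorph0 mul0r.
have th2 : 0 < theta / 2 <= 1 / 2 by lra.
rewrite exprS; apply: (rate_eq _ _ (rateM _ (fw _ th2) IH)) => //; last by case/andP: th.
by move=> j; rewrite cauchy_product_fps.
Qed.
End RateQuotient.

Section LoopExpansion.
Variables (R : realType) (J : nat -> laurent int) (Delta : laurent int).
Variables (P : nat -> laurent rat) (S : nat -> fps) (G : R).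
Hypothesis Delta1 : levalZ Delta (1 : rat) = 1.
Hypothesis S_mul : forall k,
  fps_mul (S k) (fps_pow (laurent_expZ Delta) (2 * k).+1%N) =1 laurent_expQ (P k).
Hypothesis J_expansion : forall n m, (0 < n)%N ->
  laurent_expZ (J n) m = \sum_(k < m.+1) S k (m - k)%N * n%:R ^+ (m - k).
Hypothesis G_ge1 : 1 <= G.
Hypothesis J_bound : forall n (h : R[i]), (0 < n)%N -> n%:R * modulus h <= 1 / 2 ->
  modulus (levalZ (J n) (cexp h)) <= G ^+ n.

Lemma jones_coef n d : (0 < n)%N ->
  laurent_expZ (J n) d = remainder_coef S 0 n d * n%:R ^+ d.
Proof.
move=> n0; rewrite J_expansion// /remainder_coef mulr_suml; apply: eq_bigr => i _.
have nn : n%:R != 0 :> rat by rewrite pnatr_eq0 -lt0n.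
have id_ : (i <= d)%N by rewrite -ltnS.
rewrite add0n -mulrA; congr (_ * _); move: (nat_of_ord i) id_ => k kd.
by rewrite -{2}(subnKC kd) exprD mulKf// expf_neq0.
Qed.

(** The Cauchy estimate on the circle of radius [1/(2n)], the largest one on which
    the exponential bound is available. *)
Lemma jones_coef_bound n d : (0 < n)%N ->
  `|ratr (remainder_coef S 0 n d) : R| <= G ^+ n * 2 ^+ d.
Proof.
move=> n0; have np : 0 < n%:R :> R by rewrite ltr0n.
pose r : R := (2 * n%:R)^-1; have r0 : 0 < r by rewrite invr_gt0; lra.
have h : modulus (ratr (laurent_expZ (J n) d) : R[i]) * r ^+ d <= G ^+ n.
  apply: (@cauchy_estimate R (fun z => levalZ (J n) (cexp z))
     (fun j => ratr (laurent_expZ (J n) j)) r _ d (ltW r0)) => z zr.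
    apply: J_bound => //; rewrite zr /r invfM mulrCA mulfV ?gt_eqF// mulr1; lra.
  by apply: levalZ_rate; lra.
move: h; rewrite modulus_ratr jones_coef// rmorphM rmorphXn rmorph_nat.
rewrite normrM normrX normr_nat -mulrA -exprMn => h.
rewrite -ler_pdivrMr ?exprn_gt0//; apply: le_trans h.
by rewrite /r invfM mulrCA mulfV ?gt_eqF// mulr1 exprVn.
Qed.

Variable M : R.
Hypothesis M_ge1 : 1 <= M.
Hypothesis Delta_bound :
  forall i, `|ratr (laurent_expZ Delta i.+1) : R| <= (M / 4) ^+ i.+1.
Hypothesis S_bound : forall k, exists C, forall j, `|ratr (S k j) : R| <= C * M ^+ j.

(** [Delta(e^z)] is within [1/4] of [Delta(1) = 1]. *)
Lemma Delta_cexp_neq0 (z : R[i]) : M * modulus z <= 1 / 2 ->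
  levalZ Delta (cexp z) != 0.
Proof.
move=> Mz; have M1 := M_ge1; have z0 := modulus_ge0 z.
have q0 : 0 <= M / 4 * modulus z by rewrite mulr_ge0//; lra.
have th : 0 < (1 / 2 : R) <= 1 / 2 by lra.
have := @sharper_rate _ _ _ _ 1 (M / 4 * modulus z) _ _ (levalZ_rate Delta z th).
move=> /(_ _ _ _ 1%N) h.
have : modulus (levalZ Delta (cexp z) - 1) <= 1 / 4.
  apply: (@le_trans _ _ (2 * 1 * (M / 4 * modulus z) ^+ 1)); last by rewrite expr1; lra.
  have := h; rewrite big_ord1 expr0 mulr1 laurent_expZ0// rmorph1; apply; [lra|lra|].
  case=> [|j].
    by rewrite !expr0 !mulr1 laurent_expZ0// rmorph1 modulus1.
  rewrite modulusM modulus_ratr modulusX mul1r exprMn.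
  by apply: ler_wpM2r; rewrite ?exprn_ge0.
by apply: contraTneq => ->; rewrite sub0r modulusN modulus1; lra.
Qed.

Lemma loop_term_rate k (z : R[i]) : M * modulus z <= 1 / 2 ->
  converges_at_rate (1 / 2) (fun j => ratr (S k j) * z ^+ j) (loop_term Delta P k z).
Proof.
move=> Mz; have M1 := M_ge1; have z0 := modulus_ge0 z.
have [C SC] := S_bound k.
have C0 : 0 <= C.
  by apply: le_trans (normr_ge0 _) (le_trans (SC 0%N) _); rewrite mulr1.
have th2 : 0 < (1 / 2 / 2 : R) <= 1 / 2 by lra.
have th : 0 < (1 / 2 : R) <= 1 / 2 by lra.
have D0 := expf_neq0 (2 * k).+1 (Delta_cexp_neq0 Mz).
apply: (@rate_div _ _ _ _ C _ _ _ D0 _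
  (fps_pow_rate (2 * k).+1 (fun t => @levalZ_rate R Delta z t) th2)).
- by lra.
- move=> j; rewrite modulusM modulus_ratr modulusX.
  apply: (@le_trans _ _ (C * M ^+ j * modulus z ^+ j)).
    by apply: ler_wpM2r; rewrite ?exprn_ge0.
  rewrite -mulrA -exprMn; apply: ler_wpM2l => //.
  by apply: lerXn2r; rewrite ?nnegrE ?mulr_ge0//; lra.
- apply: (rate_eq _ _ (levalQ_rate (P k) z th)) => // j.
  by rewrite cauchy_product_fps S_mul.
Qed.

Lemma loop_error_shift N n (z : R[i]) : (0 < n)%N -> z != 0 ->
  loop_error J Delta P N n z - loop_term Delta P N z =
  z / n%:R * loop_error J Delta P N.+1 n z.
Proof.
move=> n0 z0; have nn : n%:R != 0 :> R[i] by rewrite pnatr_eq0 -lt0n.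
rewrite /loop_error big_ord_recr /= exprS.
set x := levalZ _ _; set y := \sum_(i < N) _; set t := loop_term _ _ _ _.
have e : (n%:R / z) ^+ N * (z / n%:R) ^+ N = 1.
  rewrite -exprMn (_ : n%:R / z * (z / n%:R) = 1) ?expr1n//.
  by field; rewrite z0 nn.
have e1 : z / n%:R * (n%:R / z) = 1 by field; rewrite z0 nn.
transitivity ((n%:R / z) ^+ N * (x - y) - ((n%:R / z) ^+ N * (z / n%:R) ^+ N) * t).
  by rewrite e; ring.
rewrite [RHS](_ : _ = z / n%:R * (n%:R / z) *
  ((n%:R / z) ^+ N * (x - (y + t * (z / n%:R) ^+ N)))); last by ring.
by rewrite e1; ring.
Qed.

Lemma loop_error_rate N n (z : R[i]) : (0 < n)%N -> z != 0 -> M * modulus z <= 1 / 2 ->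
  converges_at_rate (1 / 2) (fun d => ratr (remainder_coef S N n d) * z ^+ d)
    (loop_error J Delta P N n z).
Proof.
move=> n0 z0 Mz; have th : 0 < (1 / 2 : R) <= 1 / 2 by lra.
have nn : n%:R != 0 :> R[i] by rewrite pnatr_eq0 -lt0n.
elim: N => [|N IH].
  rewrite /loop_error big_ord0 subr0 expr0 [X in converges_at_rate _ _ X]mul1r.
  apply: (rate_eq _ _ (levalZ_rate (J n) (z / n%:R) th)) => // d.
  rewrite jones_coef// rmorphM rmorphXn rmorph_nat -mulrA -exprMn.
  by rewrite mulrCA mulfV// mulr1.
have := rateD IH (rateZ (-1) (loop_term_rate N Mz)).
move=> /rate_shift /(rateZ (n%:R / z)).
apply: rate_eq => [d|].
  rewrite remainder_coefS rmorphD rmorphM fmorphV rmorph_nat exprS.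
  by field; rewrite z0 nn.
have e1 : n%:R / z * (z / n%:R) = 1 by field; rewrite z0 nn.
have -> : loop_error J Delta P N.+1 n z =
    n%:R / z * (loop_error J Delta P N n z - loop_term Delta P N z).
  by rewrite loop_error_shift// mulrA e1 mul1r.
by rewrite remainder_coef0; ring.
Qed.

(** Uniformly in [n], the case [m = 0] bounds the remainder and the case [m = 2]
    describes it to first order at the origin. *)
Lemma loop_error_expansion : exists2 L, 2 * M <= L &
  forall N, exists2 C, 0 <= C & forall n (z : R[i]), (0 < n)%N -> z != 0 ->
    L * modulus z <= 1 / 2 -> forall m,
    modulus (loop_error J Delta P N n z -
      \sum_(d < m) ratr (remainder_coef S N n d) * z ^+ d) <=
    C * (L * modulus z) ^+ m.
Proof.
have [L LM hL] := remainder_coef_bound M_ge1 G_ge1 S_bound jones_coef_bound.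
exists L => // N; have [C C0 hC] := hL N; exists (2 * C); first by lra.
move=> n z n0 z0 Lz m; have M1 := M_ge1; have mz := modulus_ge0 z.
have Mz : M * modulus z <= 1 / 2.
  by apply: le_trans _ Lz; apply: ler_wpM2r => //; lra.
apply: sharper_rate (loop_error_rate N n0 z0 Mz) _ m; [lra| |].
  by rewrite Lz mulr_ge0//; lra.
move=> j; rewrite modulusM modulus_ratr modulusX exprMn mulrA.
by apply: ler_wpM2r; rewrite ?exprn_ge0 ?hC.
Qed.

Lemma loop_term0 N : loop_term Delta P N (0 : R[i]) = ratr (S N 0%N).
Proof.
have [|C hC] := @loop_term_rate N 0; first by rewrite modulus0 mulr0; lra.
apply/eqP; rewrite -subr_eq0 -modulus_eq0 eq_le modulus_ge0 andbT.
apply: (@ler_geometric_error _ _ _ (C / 2) (1 / 2)) => [|n]; first by lra.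
have -> : 0 + C / 2 * (1 / 2) ^+ n = C * (1 / 2) ^+ n.+1 by rewrite exprS; field.
apply: le_trans (hC n.+1).
rewrite big_ord_recl /= expr0 mulr1 big1 ?addr0// => i _.
by rewrite /bump /= exprS mul0r mulr0.
Qed.

End LoopExpansion.

(** * Complex derivatives and uniform convergence *)

Section ComplexDerivable.
Variable R : realType.

Lemma modulus_lt_ball (x y : R[i]^o) (e : R) : ball x e%:C%C y <-> modulus (x - y) < e.
Proof. by rewrite -ball_normE /ball_ /= normE ltcR. Qed.

Lemma pos_complex (e : R[i]) : 0 < e -> exists2 r : R, 0 < r & e = r%:C%C.
Proof.
move=> e0; exists (modulus e); first by rewrite modulus_gt0 gt_eqF.
by rewrite -normE gtr0_norm.
Qed.

Lemma derivable_quadratic (f : R[i]^o -> R[i]^o) (a l : R[i]^o) (C delta : R) :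
  0 < delta ->
  (forall h, modulus h < delta -> modulus (f (a + h) - f a - l * h) <= C * modulus h ^+ 2) ->
  derivable f a 1.
Proof.
move=> d0 fC; apply/cvg_ex; exists l.
apply/cvgrPdist_le => _ /pos_complex[e e0 ->].
have C0 : 0 < 1 + `|C| by have := normr_ge0 C; lra.
exists (Num.min delta (e / (1 + `|C|)))%:C%C => /=.
  by rewrite ltcR lt_min d0 divr_gt0.
move=> h; rewrite /= sub0r normrN normE ltcR lt_min => /andP[hd he] h0.
rewrite normE lecR; have mh : 0 < modulus h by rewrite modulus_gt0.
rewrite -(ler_pM2r mh) -modulusM -modulusN.
have -> : - ((l - h^-1 *: (f (h *: 1 + a) - f a)) * h) = f (a + h) - f a - l * h.
  rewrite /GRing.scale /= mulr1 (addrC h a) mulrBl mulrAC mulVf// mul1r; ring.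
apply: le_trans (fC h hd) _; rewrite expr2 mulrA ler_pM2r//.
move: he; rewrite ltr_pdivlMr// => he.
by have := ler_norm C; nra.
Qed.

Lemma derivable_mul (f g : R[i]^o -> R[i]^o) a : derivable f a 1 ->
  derivable g a 1 -> derivable (fun z => f z * g z : R[i]^o) a 1.
Proof. by move=> df dg; apply: (@derivableM R[i] R[i]^o f g a 1 df dg). Qed.

Lemma derivable_inv (f : R[i]^o -> R[i]^o) a : f a != 0 -> derivable f a 1 ->
  derivable (fun z => (f z)^-1 : R[i]^o) a 1.
Proof. by move=> fa df; apply: (@derivableV R[i] R[i]^o f a 1 fa df). Qed.

Lemma derivable_exp (f : R[i]^o -> R[i]^o) n a : derivable f a 1 ->
  derivable (fun z => f z ^+ n : R[i]^o) a 1.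
Proof.
move=> df; elim: n => [|n IH]; first exact: derivable_cst.
have -> : (fun z => f z ^+ n.+1 : R[i]^o) = (fun z => f z * f z ^+ n : R[i]^o).
  by apply/funext => z; rewrite exprS.
exact: derivable_mul.
Qed.

Lemma derivable_bigsum m (f : nat -> R[i]^o -> R[i]^o) a :
  (forall i, derivable (f i) a 1) ->
  derivable (fun z => \sum_(i < m) f i z : R[i]^o) a 1.
Proof.
move=> df; have -> : (fun z => \sum_(i < m) f i z : R[i]^o) = \sum_(i < m) f i.
  by apply/funext => z; rewrite fct_sumE.
exact: derivable_sum.
Qed.

Lemma derivable_cexp_scaled (c a : R[i]^o) :
  derivable (fun z : R[i]^o => (cexp (c * z) : R[i]^o)) a 1.
Proof.
have c0 : 0 < 1 + modulus c by have := modulus_ge0 c; lra.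
apply: (@derivable_quadratic _ a (cexp (c * a) * c)
   (modulus (cexp (c * a)) * (2 * modulus c ^+ 2)) (1 / 2 / (1 + modulus c))).
  by rewrite divr_gt0//; lra.
move=> h hd; rewrite mulrDr cexpD.
have -> : cexp (c * a) * cexp (c * h) - cexp (c * a) - cexp (c * a) * c * h =
   cexp (c * a) * (cexp (c * h) - 1 - c * h) by ring.
rewrite modulusM -[leRHS]mulrA; apply: ler_wpM2l; first exact: modulus_ge0.
have -> : 2 * modulus c ^+ 2 * modulus h ^+ 2 = 2 * modulus (c * h) ^+ 2.
  by rewrite modulusM exprMn; ring.
apply: modulus_cexp_sub1X; rewrite modulusM.
move: hd; rewrite ltr_pdivlMr//; have := modulus_ge0 h; have := modulus_ge0 c; nra.
Qed.

Lemma derivable_leval (A : nzRingType) (g : A -> R[i]) L (c a : R[i]^o) : g 0 = 0 ->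
  derivable (fun z : R[i]^o => (leval g L (cexp (z * c)) : R[i]^o)) a 1.
Proof.
move=> g0.
have -> : (fun z : R[i]^o => (leval g L (cexp (z * c)) : R[i]^o)) =
  (fun z => \sum_(i < size (lpoly L)) (g (lpoly L)`_i *
     cexp (((i%:R - (Defs.lshift L)%:R) * c) * z)) : R[i]^o).
  apply/funext => z; rewrite leval_sum//.
  by apply: eq_bigr => i _; rewrite (mulrC z) mulrA.
apply: (@derivable_bigsum _ (fun i z => g (lpoly L)`_i *
     cexp (((i%:R - (Defs.lshift L)%:R) * c) * z))) => i.
by apply: derivable_mul; [exact: derivable_cst|exact: derivable_cexp_scaled].
Qed.

Lemma derivable_leval1 (A : nzRingType) (g : A -> R[i]) L (a : R[i]^o) : g 0 = 0 ->
  derivable (fun z : R[i]^o => (leval g L (cexp z) : R[i]^o)) a 1.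
Proof.
move=> g0; have := @derivable_leval A g L 1 a g0.
by under eq_fun do rewrite mulr1.
Qed.

Lemma derivable_loop_term Delta P k (a : R[i]^o) : levalZ Delta (cexp a) != 0 ->
  derivable (loop_term Delta P k : R[i]^o -> R[i]^o) a 1.
Proof.
move=> D0; apply: derivable_mul; first by apply: derivable_leval1; rewrite rmorph0.
apply: derivable_inv; first by rewrite expf_neq0.
by apply: derivable_exp; apply: derivable_leval1.
Qed.

Lemma derivable_loop_error J Delta P N n (a : R[i]^o) :
  a != 0 -> levalZ Delta (cexp a) != 0 ->
  derivable (loop_error J Delta P N n : R[i]^o -> R[i]^o) a 1.
Proof.
move=> a0 D0; apply: derivable_mul.
  apply: derivable_exp; apply: derivable_mul; first exact: derivable_cst.
  by apply: derivable_inv => //; exact: derivable_id.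
apply: (@derivableB _ _ _ (fun z : R[i]^o => (levalZ (J n) (cexp (z / n%:R)) : R[i]^o))).
  exact: derivable_leval.
apply: (@derivable_bigsum _ (fun k z => loop_term Delta P k z * (z / n%:R) ^+ k)) => k.
apply: derivable_mul; first exact: derivable_loop_term.
by apply: derivable_exp; apply: derivable_mul; [exact: derivable_id|exact: derivable_cst].
Qed.

Lemma uniform_rate (E : nat -> R[i]^o -> R[i]^o) (f : R[i]^o -> R[i]^o)
    (U : set R[i]^o) (C : R) :
  (forall n z, (0 < n)%N -> U z -> modulus (f z - E n z) <= C / n%:R) ->
  {uniform U, E @ \oo --> f}.
Proof.
move=> EC W /uniform_nbhs[V [entV VW]].
move: entV; rewrite -entourage_ballE => -[_ /= /pos_complex[e e0 ->] eV].
have [m Cm] : exists m : nat, C / e < m%:R.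
  by exists (Num.truncn `|C / e|).+1; apply: le_lt_trans (ler_norm _) (truncnS_gt _).
exists m.+1 => // n /= mn; apply: VW => z Uz; apply: eV => /=.
apply/modulus_lt_ball; have n0 : (0 < n)%N by apply: leq_trans mn.
apply: le_lt_trans (EC n z n0 Uz) _.
rewrite ltr_pdivrMr ?ltr0n// mulrC -ltr_pdivrMr//; apply: lt_le_trans Cm _.
by rewrite ler_nat ltnW.
Qed.

End ComplexDerivable.

(** * The asymptotic expansion *)

Theorem theorem4 (R : realType) (K : knot) (J : nat -> laurent int)
    (Delta : laurent int) (P : nat -> laurent rat)
    (hJ : forall n : nat, (0 < n)%N -> is_colored_jones K n (J n))
    (hDelta : is_alexander K Delta)
    (hP : is_loop_expansion J Delta P) :
  exists U : set R[i]^o,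
    [/\ open U, U 0,
        (forall alpha, U alpha -> levalZ Delta (cexp alpha) != 0)
      & forall N : nat, exists E : nat -> R[i]^o -> R[i]^o,
        [/\ (forall (n : nat) (alpha : R[i]^o), (0 < n)%N -> U alpha ->
               derivable (E n) alpha 1 /\
               (alpha != 0 -> E n alpha = loop_error J Delta P N n alpha)),
            (forall alpha, U alpha ->
               E n alpha @[n --> \oo] --> (loop_term Delta P N alpha : R[i]^o))
          & (forall C : set R[i]^o, compact C -> C `<=` U ->
               {uniform C, E @ \oo --> (loop_term Delta P N : R[i]^o -> R[i]^o)})]].
Proof.
case: hDelta => _ _ Delta1; case: hP => _ [S [S_mul J_expansion]].
pose G : R := 8 * diagram_bound R (zero_framed K).
have G_ge1 : 1 <= G by have := diagram_bound_ge1 R (zero_framed K); rewrite /G; lra.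
have J_bound n (h : R[i]) : (0 < n)%N -> n%:R * modulus h <= 1 / 2 ->
    modulus (levalZ (J n) (cexp h)) <= G ^+ n.
  by move=> n0 hn; apply: colored_jones_bound n0 hn _ _ (hJ n n0).
have [M [M_ge1 Delta_bound S_bound]] := @loop_coef_bound R Delta P S Delta1 S_mul.
have [L LM expansion] :=
  loop_error_expansion Delta1 S_mul J_expansion G_ge1 J_bound M_ge1 Delta_bound S_bound.
have L0 : 0 < L by lra.
pose rho : R := 1 / 2 / L; have rho0 : 0 < rho by rewrite divr_gt0//; lra.
have in_disc z : modulus z < rho -> L * modulus z <= 1 / 2.
  by move=> /ltW; rewrite ler_pdivlMr// mulrC.
have in_disc_M z : modulus z < rho -> M * modulus z <= 1 / 2.
  move=> /in_disc; apply: le_trans; apply: ler_wpM2r; [exact: modulus_ge0|lra].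
pose U : set R[i]^o := [set z | modulus z < rho].
have Delta_neq0 z : U z -> levalZ Delta (cexp z) != 0.
  by move=> /in_disc_M; exact: Delta_cexp_neq0.
exists U; split=> //.
- have -> : U = ball (0 : R[i]^o) rho%:C%C.
    apply/seteqP; split=> z; last by move=> /modulus_lt_ball; rewrite sub0r modulusN.
    by move=> Uz; apply/modulus_lt_ball; rewrite sub0r modulusN.
  exact: ball_open.
- by rewrite /U /= modulus0.
(* The value at 0 is the constant coefficient of the expansion of the remainder. *)
move=> N; pose E n (z : R[i]^o) : R[i]^o :=
  if z == 0 then ratr (S N 0%N) else loop_error J Delta P N n z.
have [C C0 hC] := expansion N; have [C' C'0 hC'] := expansion N.+1.
have rate n z : (0 < n)%N -> U z ->
    modulus (loop_term Delta P N z - E n z) <= rho * C' / n%:R.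
  move=> n0 Uz; rewrite /E; case: eqVneq => [->|z0].
    rewrite (loop_term0 Delta1 S_mul M_ge1 Delta_bound S_bound) subrr modulus0.
    by rewrite divr_ge0// mulr_ge0// ltW.
  rewrite -modulusN opprB loop_error_shift// modulusM modulusM modulusV modulus_nat.
  rewrite mulrAC; apply: ler_wpM2r; first by rewrite invr_ge0.
  apply: ler_pM; rewrite ?modulus_ge0//; first exact: ltW.
  have := hC' n z n0 z0 (in_disc z Uz) 0%N.
  by rewrite big_ord0 subr0 expr0 mulr1.
exists E; split.
- move=> n z n0 Uz; split; last by rewrite /E => /negPf->.
  have [->|z0] := eqVneq z 0.
    apply: (@derivable_quadratic _ _ _
      (ratr (remainder_coef S N n 1)) (C * L ^+ 2) rho) => // h hrho.
    rewrite add0r /E eqxx; case: eqVneq => [->|h0].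
      by rewrite subrr mulr0 subr0 modulus0 expr0n /= mulr0.
    rewrite -[leRHS]mulrA -exprMn; apply: le_trans (hC n h n0 h0 (in_disc h hrho) 2%N).
    rewrite !big_ord_recl big_ord0 /= remainder_coef0 expr0 expr1 mulr1 addr0.
    by rewrite opprD addrA.
  apply: (@near_eq_derivable _ _ _ (loop_error J Delta P N n : R[i]^o -> R[i]^o)).
    exists (modulus z)%:C%C => /=; first by rewrite ltcR modulus_gt0.
    move=> y; rewrite /= normE ltcR /E; case: eqVneq => // ->.
    by rewrite subr0 ltxx.
  exact: derivable_loop_error z0 (Delta_neq0 z Uz).
- move=> z Uz; have := @uniform_rate R E (loop_term Delta P N) [set z] (rho * C').
  by rewrite uniform_set1; apply=> n _ n0 ->; exact: rate.
- move=> A _ AU; apply: (@uniform_rate R E (loop_term Delta P N) A (rho * C')).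
  by move=> n z n0 /AU; exact: rate.
Qed.
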